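(* Consider the linear recursion setting below with any fixed (deterministic) initial condition $e(0)$, and suppose Assumption 3 holds. Then $\lim_{t\to\infty}\mathbb{E}\{\|e(t)\|^2\}=0$. If in addition (a) $\sum_{t=1}^\infty\alpha(t)^{2(1-\delta)}<\infty$ with $\delta$ from Assumption 3 (iii.a), (b) $\sum_{t=1}^\infty\alpha(t)g_2(t)<\infty$, and (c) $\varepsilon'(t)=u(t)w(t)$ with $u(t)\in\mathbb{R}^{q\times q}$, $w(t)\in\mathbb{R}^q$, where $\{w(t)\}$ is independent of $\{Q(t),\Delta(t),u(t)\}$ and $\{w(t),\mathcal{F}(t)\}$ is a martingale difference sequence, then $\mathbb{P}\{\lim_{t\to\infty}e(t)=0\}=1$.
   Context: Linear recursion setting: $e(t+1)=e(t)+\alpha(t)(Q(t)+\Delta(t))e(t)+\alpha(t)(\varepsilon'(t)+\varepsilon''(t))$, $t\in\mathbb{N}$, with $e(t),\varepsilon'(t),\varepsilon''(t)\in\mathbb{R}^q$, random $Q(t),\Delta(t)\in\mathbb{R}^{q\times q}$, and deterministic scalar step size $\alpha(t)$. $\mathcal{F}(t)=\sigma(Q(s),\Delta(s),\varepsilon'(s),0\le s\le t)$, $\mathcal{F}(-1)=\{\emptyset,\Omega\}$. Assumption 3: (i) $\alpha(t)>0$, $\alpha(t)\to0$, $\sum_t\alpha(t)=\infty$, $1/\alpha(t+1)-1/\alpha(t)\to\alpha_0\ge0$. (ii.a) $\sup_t\|Q(t)\|\le\pi_1<\infty$ a.s., and there exist $h\in\mathbb{N}^+$, $\lambda>0$ with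 $\lambda_{\max}\big[\sum_{t=mh}^{(m+1)h-1}\mathbb{E}\{Q(t)+Q^{\sf T}(t)\mid\mathcal{F}(mh-1)\}\big]\le-\lambda$ a.s. for all $m\in\mathbb{N}$. (ii.b) $\|\Delta(t)\|\le g_1(t)$ a.s., where $g_1$ is a deterministic measurable function with $g_1(t)\to0$ and $\sup_{t\ge0}g_1(t)<\infty$. (iii.a) $\{\varepsilon'(t),\mathcal{F}(t)\}$ is a martingale difference sequence and $\sup_t\mathbb{E}\{\|\alpha^\delta(t)\varepsilon'(t)\|^2\mid\mathcal{F}(t-1)\}\le c_\varepsilon$ a.s. for a constant $c_\varepsilon>0$ and some $\delta\in[0,1/2)$. (iii.b) $\varepsilon''(t)$ is $\mathcal{F}(t)$-measurable and $\|\varepsilon''(t)\|\le g_2(t)$ a.s., where $g_2$ is a deterministic measurable function with $g_2(t)\to0$ and $\sup_{t\ge0}g_2(t)<\infty$. *)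

(* Defs.v *)
From HB Require Import structures.
From mathcomp Require Import all_boot all_order all_algebra.
From mathcomp Require Import all_classical all_reals all_analysis.
Set Implicit Arguments. Unset Strict Implicit. Unset Printing Implicit Defensive.
Import Order.TTheory GRing.Theory Num.Theory.
Import numFieldNormedType.Exports.
Local Open Scope classical_set_scope.
Local Open Scope ring_scope.

Section defs.
Context {R : realType}.

Definition vnorm {q : nat} (v : 'cV[R]_q) : R :=
  Num.sqrt (\sum_(i < q) (v i 0) ^+ 2).

Definition opnorm {q : nat} (A : 'M[R]_q) : R :=
  sup [set vnorm (A *m v) | v in [set v : 'cV[R]_q | vnorm v <= 1]].

(* Largest eigenvalue of a (symmetric) matrix, via the Rayleigh quotient *)
Definition lambda_max {q : nat} (A : 'M[R]_q) : R :=
  sup [set (v^T *m A *m v) 0 0 | v in [set v : 'cV[R]_q | vnorm v = 1]].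

Context {d : measure_display} {T : measurableType d}.

Definition sub_sigma (G : set_system T) : Prop :=
  sigma_algebra setT G /\ (forall A, G A -> measurable A).

Definition G_measurable (G : set_system T) (X : T -> R) : Prop :=
  forall B : set R, measurable B -> G (X @^-1` B).

Definition is_cond_exp (P : probability T R) (G : set_system T)
    (X Y : T -> R) : Prop :=
  P.-integrable setT (EFin \o X) /\
  G_measurable G Y /\ P.-integrable setT (EFin \o Y) /\
  (forall A, G A -> (\int[P]_(w in A) (X w)%:E = \int[P]_(w in A) (Y w)%:E)%E).

Definition indep_sigma (P : probability T R) (G1 G2 : set_system T) : Prop :=
  forall A B, G1 A -> G2 B -> P (A `&` B) = (P A * P B)%E.

Definition gen_sets {I : Type} {m n : nat} (X : I -> T -> 'M[R]_(m, n)) :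
    set_system T :=
  [set A | exists k (i : 'I_m) (j : 'I_n) (B : set R),
          measurable B /\ A = (fun w => X k w i j) @^-1` B].

(* F(t-1) = sigma(Q(s), Delta(s), eps'(s), s < t); so F(-1) = {set0, setT} *)
Definition Fpast {q : nat} (Q Delta : nat -> T -> 'M[R]_q)
    (eps1 : nat -> T -> 'cV[R]_q) (t : nat) : set_system T :=
  <<s [set A | exists s (i j : 'I_q) (B : set R),
         (s < t)%N /\ measurable B /\
         [\/ A = (fun w => Q s w i j) @^-1` B,
             A = (fun w => Delta s w i j) @^-1` B |
             A = (fun w => eps1 s w i 0) @^-1` B]] >>.

(* vector-valued martingale difference sequence w.r.t. filtration Fpast:
   x(t) is F(t)-measurable, integrable, and E{x(t) | F(t-1)} = 0 *)
Definition mds (P : probability T R) {q : nat} (F : nat -> set_system T)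
    (x : nat -> T -> 'cV[R]_q) : Prop :=
  forall t (i : 'I_q),
    G_measurable (F t.+1) (fun w => x t w i 0) /\
    is_cond_exp P (F t) (fun w => x t w i 0) (fun _ => 0).

End defs.

(* Main.v *)
Require Import Defs.
From HB Require Import structures.
From mathcomp Require Import all_boot all_order all_algebra.
From mathcomp Require Import all_classical all_reals all_analysis.
From mathcomp Require Import measurable_realfun ring lra.
Import Order.TTheory GRing.Theory Num.Theory.
Import numFieldNormedType.Exports.
Local Open Scope classical_set_scope.
Local Open Scope ring_scope.
Set Implicit Arguments.
Unset Strict Implicit.
Unset Printing Implicit Defensive.

(* Write V_m = |e(mh)|^2 and a = alpha(mh). Expanding the recursion over one
   block of length h, freezing e(t) and alpha(t) at the start of the block (the
   errors are o(a) V_m plus noise), and integrating over A in F(mh - 1) gives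
     int_A V_(m+1) <= (1 - k s_m) int_A V_m + C b_m P(A),
   where s_m is the sum over the block of the step sizes and b_m that of
   alpha^(2(1 - delta)) c_eps + alpha g_2. With A the whole space,
   b_m = o(s_m) and sum_m s_m = oo, this yields E V_m -> 0. When the b_m are
   summable, V_m is a supermartingale up to a summable defect, and the maximal
   inequality bounds P(sup_(m >= n) V_m >= eps) by (E V_n + C sum_(m >= n) b_m) / eps,
   which tends to 0. Inside a block, |e(t)|^2 is controlled by V_m and by the
   noise alpha^2 |eps'|^2, to which the same two arguments apply. *)

(** * Euclidean norms and the recursion along one trajectory *)

(** The matrices are stable only on average over [h] steps, so no one-step contraction is available;
    this forces the blocks. The limit of 1/alpha(t+1) - 1/alpha(t) makes alpha(t+j)/alpha(t) tend to
    1, so freezing the step size costs o(alpha). The noise contributes alpha^2 |eps'|^2, whose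
    conditional mean is at most c_eps alpha^(2(1 - delta)); delta < 1/2 makes this o(alpha), hence
    b_m = o(s_m). The obstacle is integrability: the cross terms pair eps' with an unbounded e(mh),
    and the second moment of e is not known to be finite in advance. The block inequality is
    therefore proved on events where |e(mh)| is bounded and then extended by monotone convergence.
    Conditional expectations enter only through integrals over past events, so that one block
    inequality serves both the mean (whole space) and the maximal inequality (the event of no
    crossing so far). *)

Definition dot {R : realType} {q : nat} (u v : 'cV[R]_q) : R :=
  \sum_(i < q) u i 0 * v i 0.

Section vector_norm.
Context {R : realType} {q : nat}.
Implicit Types (u v : 'cV[R]_q) (A : 'M[R]_q) (c : R).

Lemma dotC u v : dot u v = dot v u.
Proof. by apply: eq_bigr => i _; rewrite mulrC. Qed.

Lemma dotDr u v w : dot u (v + w) = dot u v + dot u w.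
Proof. by rewrite -big_split; apply: eq_bigr => i _; rewrite mxE mulrDr. Qed.

Lemma dotZr c u v : dot u (c *: v) = c * dot u v.
Proof. by rewrite mulr_sumr; apply: eq_bigr => i _; rewrite mxE; ring. Qed.

Lemma dotNr u v : dot u (- v) = - dot u v.
Proof. by rewrite -scaleN1r dotZr mulN1r. Qed.

Lemma dot0r u : dot u 0 = 0.
Proof. by rewrite /dot big1// => i _; rewrite mxE mulr0. Qed.

Lemma dot_sumr n u (F : nat -> 'cV[R]_q) :
  dot u (\sum_(j < n) F j) = \sum_(j < n) dot u (F j).
Proof.
by elim: n => [|n IH]; rewrite ?big_ord0 ?dot0r// !big_ord_recr dotDr IH.
Qed.

Lemma vnorm_ge0 v : 0 <= vnorm v.
Proof. exact: sqrtr_ge0. Qed.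

Lemma vnorm_sqr v : vnorm v ^+ 2 = dot v v.
Proof.
rewrite sqr_sqrtr; first by apply: eq_bigr => i _; rewrite expr2.
by apply: sumr_ge0 => i _; exact: sqr_ge0.
Qed.

Lemma vnormD_sqr u v :
  vnorm (u + v) ^+ 2 = vnorm u ^+ 2 + 2 * dot u v + vnorm v ^+ 2.
Proof. by rewrite !vnorm_sqr !dotDr ![dot (_ + _) _]dotC !dotDr (dotC v); ring. Qed.

Lemma vnormZ c v : vnorm (c *: v) = `|c| * vnorm v.
Proof.
rewrite -sqrtr_sqr -sqrtrM ?sqr_ge0// mulr_sumr; congr Num.sqrt.
by apply: eq_bigr => i _; rewrite mxE exprMn.
Qed.

Lemma vnormN v : vnorm (- v) = vnorm v.
Proof. by rewrite -scaleN1r vnormZ normrN1 mul1r. Qed.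

Lemma ler_coord_vnorm v i : `|v i 0| <= vnorm v.
Proof.
rewrite -(@ler_pXn2r _ 2) ?nnegrE ?vnorm_ge0// vnorm_sqr real_normK ?num_real//.
rewrite /dot (bigD1 i)//= expr2 lerDl sumr_ge0// => j _.
by rewrite -expr2 sqr_ge0.
Qed.

Lemma vnorm_eq0 v : vnorm v = 0 -> v = 0.
Proof.
move=> v0; apply/colP => i; rewrite mxE; apply/eqP; rewrite -normr_le0 -v0.
exact: ler_coord_vnorm.
Qed.

Lemma vnorm0 : vnorm (0 : 'cV[R]_q) = 0.
Proof. by rewrite -(scale0r 0) vnormZ normr0 mul0r. Qed.

(** Cauchy-Schwarz: expand the square of the norm of |v| u - |u| v and divide by |u| |v|, the zero
    cases being apart. *)
Lemma dot_le u v : dot u v <= vnorm u * vnorm v.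
Proof.
have [u0|] := eqVneq (vnorm u) 0.
  by rewrite (vnorm_eq0 u0) dotC dot0r vnorm0 mul0r.
have [v0|v0 u0] := eqVneq (vnorm v) 0.
  by rewrite (vnorm_eq0 v0) dot0r vnorm0 mulr0.
have xy : 0 < vnorm u * vnorm v by rewrite mulr_gt0// lt_def ?u0 ?v0 vnorm_ge0.
have := sqr_ge0 (vnorm (vnorm v *: u - vnorm u *: v)).
rewrite vnormD_sqr dotNr dotZr dotC dotZr vnormN !vnormZ !exprMn dotC.
rewrite !real_normK ?num_real// => H.
rewrite -(ler_pM2l xy); nra.
Qed.

Lemma normr_dot_le u v : `|dot u v| <= vnorm u * vnorm v.
Proof.
rewrite ler_norml dot_le andbT lerNl -dotNr -(vnormN v); exact: dot_le.
Qed.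

Lemma ler_vnormD u v : vnorm (u + v) <= vnorm u + vnorm v.
Proof.
rewrite -(@ler_pXn2r _ 2) ?nnegrE ?addr_ge0 ?vnorm_ge0// vnormD_sqr.
have := dot_le u v; lra.
Qed.

Lemma vnorm_mulmx_le_opnorm A v : vnorm v <= 1 -> vnorm (A *m v) <= opnorm A.
Proof.
move=> v1; apply: ub_le_sup; last by exists v.
(* A [sup] dominates its set only when the set is bounded; the Frobenius norm of [A] is a bound. *)
exists (Num.sqrt (\sum_i vnorm (row i A)^T ^+ 2)) => _ [w /= w1 <-].
rewrite ler_sqrt ?sumr_ge0// => [|i _]; last exact: sqr_ge0.
apply: ler_sum => i _.
have -> : (A *m w) i 0 = dot (row i A)^T w.
  by rewrite !mxE; apply: eq_bigr => j _; rewrite !mxE.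
rewrite -real_normK ?num_real// lerXn2r ?nnegrE ?vnorm_ge0//.
apply: le_trans (normr_dot_le _ _) _.
by rewrite ler_piMr// vnorm_ge0.
Qed.

Lemma opnorm_ge0 A : 0 <= opnorm A.
Proof.
apply: le_trans (vnorm_ge0 (A *m 0)) (vnorm_mulmx_le_opnorm A _).
by rewrite vnorm0.
Qed.

Lemma vnorm_mulmx_le A v : vnorm (A *m v) <= opnorm A * vnorm v.
Proof.
have bnd u := @vnorm_mulmx_le_opnorm A u.
have [v0|v0] := eqVneq (vnorm v) 0.
  by rewrite (vnorm_eq0 v0) mulmx0 vnorm0 mulr0.
have vp : 0 < vnorm v by rewrite lt_def v0 vnorm_ge0.
have := bnd ((vnorm v)^-1 *: v).
rewrite -scalemxAr !vnormZ gtr0_norm ?invr_gt0// mulVf// => /(_ (lexx _)).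
by rewrite mulrC ler_pdivrMr.
Qed.

(* [sup] of an unbounded set is 0, so a negative [lambda_max] already forces
   the Rayleigh quotients to be bounded. *)
Lemma lambda_max_dot_le A l v : 0 < l -> lambda_max A <= - l ->
  dot v (A *m v) <= - l * vnorm v ^+ 2.
Proof.
move=> l0 Al; have [v0|v0] := eqVneq (vnorm v) 0.
  by rewrite (vnorm_eq0 v0) mulmx0 dot0r vnorm0 expr0n mulr0.
have vp : 0 < vnorm v by rewrite lt_def v0 vnorm_ge0.
have rayleigh u : (u^T *m A *m u) 0 0 = dot u (A *m u).
  by rewrite -mulmxA !mxE; apply: eq_bigr => i _; rewrite !mxE.
have hs : has_sup [set (v^T *m A *m v) 0 0 | v in [set v : 'cV[R]_q | vnorm v = 1]].
  apply: contrapT => /sup_out; rewrite -/(lambda_max A) => s0.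
  by move: Al; rewrite s0 oppr_ge0 leNgt l0.
set u := (vnorm v)^-1 *: v.
have u1 : vnorm u = 1 by rewrite vnormZ gtr0_norm ?invr_gt0// mulVf.
have : dot u (A *m u) <= - l.
  rewrite -rayleigh; apply: le_trans Al; apply: ub_le_sup; first exact: hs.2.
  by exists u.
rewrite /u -scalemxAr dotZr dotC dotZr dotC mulrA -invfM -expr2.
by rewrite mulrC ler_pdivrMr ?exprn_gt0.
Qed.

End vector_norm.

Lemma sqr_sum_le {R : realType} (h : nat) (y : nat -> R) :
  (\sum_(j < h) y j) ^+ 2 <= h%:R * \sum_(j < h) y j ^+ 2.
Proof.
elim: h => [|h IH]; first by rewrite !big_ord0 expr0n mul0r.
rewrite !big_ord_recr/= mulrDr -natr1.
set S := \sum_(_ < _) _ in IH *; set T := \sum_(_ < _) _ in IH *.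
(* After multiplication by [h] this is (S - h y_h)^2 >= 0 combined with the induction hypothesis S^2
   <= h T. *)
have : 2 * S * y h <= T + h%:R * y h ^+ 2.
  have [h0|h0] := posnP h.
    by rewrite /S /T h0 !big_ord0; lra.
  have hp : (0 : R) < h%:R by rewrite ltr0n.
  rewrite -(ler_pM2l hp).
  have := sqr_ge0 (S - h%:R * y h). nra.
nra.
Qed.

(** * Pathwise estimates over one block of the recursion *)

Section perturbed_linear_recursion.
Context {R : realType} {q : nat}.
Variables (x : nat -> 'cV[R]_q) (Q D : nat -> 'M[R]_q) (f1 f2 : nat -> 'cV[R]_q).
Variables (al g1 g2 : nat -> R) (A M G p : R).
Hypothesis xS : forall k, x k.+1 = x k + al k *: ((Q k + D k) *m x k)
                                   + al k *: (f1 k + f2 k).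
Hypothesis al_ge0 : forall k, 0 <= al k.
Hypothesis al_le : forall k, al k <= A.
Hypothesis Q_le : forall k v, vnorm (Q k *m v) <= p * vnorm v.
Hypothesis D_le : forall k v, vnorm (D k *m v) <= g1 k * vnorm v.
Hypothesis p_ge0 : 0 <= p.
Hypothesis g1_ge0 : forall k, 0 <= g1 k.
Hypothesis M_ge : forall k, p + g1 k <= M.
Hypothesis f2_le : forall k, vnorm (f2 k) <= g2 k.
Hypothesis g2_le : forall k, g2 k <= G.

Let A_ge0 : 0 <= A. Proof. exact: le_trans (al_le 0). Qed.
Let M_ge0 : 0 <= M.
Proof. by apply: le_trans (M_ge 0); rewrite addr_ge0. Qed.
Let g2_ge0 k : 0 <= g2 k.
Proof. by apply: le_trans (f2_le k); exact: vnorm_ge0. Qed.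
Let G_ge0 : 0 <= G. Proof. exact: le_trans (g2_ge0 0) (g2_le 0). Qed.

(** Discrete Gronwall: |x k| <= |x k - x 0| + |x 0|, so one step multiplies the deviation by at most
    1 + A M and adds one term of the sum; that new term can carry the full power because the power
    is at least 1. *)
Lemma perturbed_drift_le k : vnorm (x k - x 0%N) <=
  (1 + A * M) ^+ k *
  \sum_(j < k) al j * (M * vnorm (x 0%N) + vnorm (f1 j + f2 j)).
Proof.
elim: k => [|k IH].
  by rewrite subrr vnorm0 big_ord0 mulr0.
set X := vnorm (x 0%N) in IH *; rewrite big_ord_recr/=.
set S := \sum_(_ < _) _ in IH *; set F := vnorm (f1 k + f2 k).
set K := (_ ^+ k) in IH *.
have K1 : 1 <= K by apply: exprn_ege1; rewrite lerDl mulr_ge0.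
have S0 : 0 <= S.
  by apply: sumr_ge0 => j _; rewrite mulr_ge0 ?addr_ge0 ?mulr_ge0 ?vnorm_ge0.
have B_le v : vnorm ((Q k + D k) *m v) <= M * vnorm v.
  rewrite mulmxDl (le_trans (ler_vnormD _ _))//.
  apply: le_trans (lerD (Q_le _ _) (D_le _ _)) _.
  by rewrite -mulrDl ler_wpM2r ?vnorm_ge0.
set dk := vnorm (x k - x 0%N) in IH *.
have xk : vnorm (x k) <= dk + X by rewrite -{1}(subrK (x 0%N) (x k)) ler_vnormD.
have step : vnorm (x k.+1 - x 0%N) <= dk + al k * (M * (dk + X)) + al k * F.
  have -> : x k.+1 - x 0%N =
      (x k - x 0%N) + (al k *: ((Q k + D k) *m x k) + al k *: (f1 k + f2 k)).
    by rewrite xS -!addrA; congr (_ + _); rewrite addrA addrC.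
  rewrite -[leRHS]addrA.
  apply: le_trans (ler_vnormD _ _) _; rewrite lerD2l.
  apply: le_trans (ler_vnormD _ _) _; rewrite !vnormZ ger0_norm//.
  rewrite lerD2r ler_wpM2l//; apply: le_trans (B_le _) _.
  by rewrite ler_wpM2l.
apply: le_trans step _; rewrite exprS -/K.
have F0 : 0 <= F := vnorm_ge0 _.
have X0 : 0 <= X := vnorm_ge0 _.
have MX0 : 0 <= M * X + F by rewrite addr_ge0 ?mulr_ge0.
have d0 : 0 <= dk := vnorm_ge0 _.
apply: (@le_trans _ _ ((1 + A * M) * (K * S) + al k * (M * X + F))).
  have -> : dk + al k * (M * (dk + X)) + al k * F =
     (1 + al k * M) * dk + al k * (M * X + F) by ring.
  rewrite lerD2r; apply: ler_pM => //; first by rewrite addr_ge0 ?mulr_ge0.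
  by rewrite lerD2l ler_wpM2r.
rewrite [leRHS]mulrDr mulrA lerD2l ler_peMl ?mulr_ge0//.
by rewrite mulr_ege1// lerDl mulr_ge0.
Qed.

(** The noise [f1] appears only squared, since its linear contribution will have mean zero. No
    cancellation is available for [f2], so its bound [g2] enters to the first power. *)
Definition forcing (h : nat) : R :=
  \sum_(j < h) (al j ^+ 2 * vnorm (f1 j) ^+ 2 + al j * g2 j).

Let gs : nat -> R := fun j => al j * vnorm (f1 j + f2 j).

(** Cauchy-Schwarz over the [h] steps; the square of al g2 is then traded for A G times its first
    power, the only one present in [forcing]. *)
Lemma perturbed_forcing_le h : (\sum_(j < h) gs j) ^+ 2 <=
  2 * h%:R * (1 + A * G) * forcing h.
Proof.
apply: le_trans (sqr_sum_le _ _) _.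
rewrite -!mulrA mulrCA ler_wpM2l//.
rewrite /forcing mulr_sumr mulr_sumr; apply: ler_sum => j _.
have := ler_vnormD (f1 j) (f2 j); have := f2_le j; have := g2_le j.
rewrite /gs.
have := vnorm_ge0 (f1 j + f2 j).
set a := vnorm (_ + _); set c := vnorm (f2 j); set b := vnorm _ => a0 gG cg abc.
have b0 : 0 <= b by exact: vnorm_ge0.
have c0 : 0 <= c by exact: vnorm_ge0.
have a2 : a ^+ 2 <= 2 * (b ^+ 2 + g2 j ^+ 2).
  apply: (@le_trans _ _ ((b + g2 j) ^+ 2)).
    by rewrite lerXn2r ?nnegrE ?addr_ge0//; lra.
  have := sqr_ge0 (b - g2 j); nra.
rewrite exprMn; apply: (@le_trans _ _ (al j ^+ 2 * (2 * (b ^+ 2 + g2 j ^+ 2)))).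
  by rewrite ler_wpM2l ?sqr_ge0.
have g22 : al j ^+ 2 * g2 j ^+ 2 <= A * G * (al j * g2 j).
  rewrite -exprMn expr2 ler_wpM2r ?mulr_ge0// ler_pM//.
have : 0 <= A * G * (al j ^+ 2 * b ^+ 2).
  by rewrite !mulr_ge0 ?sqr_ge0.
have : 0 <= al j * g2 j by rewrite mulr_ge0.
nra.
Qed.

Lemma forcing_ge0 h : 0 <= forcing h.
Proof.
apply: sumr_ge0 => j _.
by apply: addr_ge0; apply: mulr_ge0 => //; exact: sqr_ge0.
Qed.

Let dr h := (1 + A * M) ^+ h *
  (M * (\sum_(j < h) al j) * vnorm (x 0%N) + \sum_(j < h) gs j).

Let drift_le h k : (k <= h)%N -> vnorm (x k - x 0%N) <= dr h.
Proof.
move=> kh; apply: le_trans (perturbed_drift_le k) _.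
have t0 j : 0 <= al j * (M * vnorm (x 0%N) + vnorm (f1 j + f2 j)).
  by rewrite mulr_ge0 ?addr_ge0 ?mulr_ge0 ?vnorm_ge0.
have -> : dr h = (1 + A * M) ^+ h *
  \sum_(j < h) al j * (M * vnorm (x 0%N) + vnorm (f1 j + f2 j)).
  rewrite /dr; congr (_ * _); rewrite mulr_sumr mulr_suml -big_split/=.
  by apply: eq_bigr => j _; rewrite /gs; ring.
apply: ler_pM.
- by apply: exprn_ge0; rewrite addr_ge0 ?mulr_ge0.
- exact: sumr_ge0.
- by apply: ler_weXn2l => //; rewrite lerDl mulr_ge0.
- rewrite -!(big_mkord xpredT (fun j => al j * (M * vnorm (x 0%N) + vnorm (f1 j + f2 j)))).
  by rewrite (@big_cat_nat _ _ _ k 0 h)//= lerDl sumr_ge0.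
Qed.

Let dr_sqr h : dr h ^+ 2 <=
  2 * ((1 + A * M) ^+ h) ^+ 2 * (M ^+ 2 * (\sum_(j < h) al j) ^+ 2 * vnorm (x 0%N) ^+ 2
    + 2 * h%:R * (1 + A * G) * forcing h).
Proof.
rewrite /dr exprMn -[leRHS]mulrA [leRHS]mulrCA.
rewrite ler_wpM2l ?sqr_ge0//.
apply: le_trans (_ : 2 * ((M * (\sum_(j < h) al j) * vnorm (x 0%N)) ^+ 2 +
  (\sum_(j < h) gs j) ^+ 2) <= _).
  set a := _ * vnorm _; set b := \sum_(_ < _) _.
  have := sqr_ge0 (a - b); nra.
by rewrite ler_wpM2l// !exprMn lerD2l perturbed_forcing_le.
Qed.

(** Serves to pass from the block starts to all times, and to keep moments finite; stability of [Q]
    is not exploited, so any constant independent of the block will do. *)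
Lemma perturbed_growth_le h k : (k <= h)%N -> vnorm (x k) ^+ 2 <=
  (2 + 4 * ((1 + A * M) ^+ h) ^+ 2 * (M ^+ 2 * (h%:R * A) ^+ 2
     + 2 * h%:R * (1 + A * G))) * (vnorm (x 0%N) ^+ 2 + forcing h).
Proof.
move=> kh; have := drift_le kh; have := dr_sqr h.
have := forcing_ge0 h; have := sqr_ge0 (vnorm (x 0%N)).
have := sqr_ge0 ((1 + A * M) ^+ h).
have : vnorm (x k) <= vnorm (x k - x 0%N) + vnorm (x 0%N).
  by rewrite -{1}(subrK (x 0%N) (x k)) ler_vnormD.
have s0 : 0 <= \sum_(j < h) al j by apply: sumr_ge0.
have : (\sum_(j < h) al j) ^+ 2 <= (h%:R * A) ^+ 2.
  rewrite lerXn2r ?nnegrE ?mulr_ge0//.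
  apply: le_trans (_ : \sum_(j < h) A <= _); first exact: ler_sum.
  by rewrite sumr_const card_ord mulr_natl.
have c0 : 0 <= 2 * h%:R * (1 + A * G).
  by rewrite !mulr_ge0// addr_ge0// mulr_ge0.
have := vnorm_ge0 (x k); have := vnorm_ge0 (x k - x 0%N); have := vnorm_ge0 (x 0%N).
set X := vnorm (x 0%N); set d := vnorm (_ - _); set y := vnorm (x k).
set W := forcing h; set K2 := (_ ^+ h) ^+ 2; set s2 := (\sum_(j < h) al j) ^+ 2.
set H := (_ * A) ^+ 2; set c := 2 * _ * _ in c0 *; set r := dr h.
set M2 := M ^+ 2; set X2 := X ^+ 2.
have M20 : 0 <= M2 := sqr_ge0 M.
move=> X0 d0 y0 sH ydX K0 X20 W0 r2 dle.
have y2 : y ^+ 2 <= 2 * X2 + 2 * r ^+ 2.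
  apply: le_trans (_ : (r + X) ^+ 2 <= _).
    rewrite lerXn2r ?nnegrE ?addr_ge0//; [exact: le_trans d0 dle|].
    by apply: le_trans ydX _; rewrite lerD2r.
  by rewrite /X2; have := sqr_ge0 (r - X); nra.
apply: le_trans y2 _.
have H0 : 0 <= H := sqr_ge0 _.
have : M2 * s2 * X2 + c * W <= (M2 * H + c) * (X2 + W).
  have : M2 * s2 * X2 <= M2 * H * X2 by rewrite ler_wpM2r// ler_wpM2l.
  have : 0 <= M2 * H * W by rewrite !mulr_ge0.
  have : 0 <= c * X2 by rewrite mulr_ge0.
  nra.
move=> /(ler_wpM2l K0).
nra.
Qed.

(** Expand |x 0 + (x h - x 0)|^2. In the cross term, [x j] is replaced by [x 0] and [al j] by [a] in
    front of [Q j], each replacement leaving an error term. The noise is kept exactly, paired with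
    [x 0], so that it can later integrate to zero; 2 x.Qx = x.(Q + Q^T)x produces the symmetric
    part. *)
Lemma perturbed_block_le h a :
  vnorm (x h) ^+ 2 <=
    vnorm (x 0%N) ^+ 2 * (1 +
      (2 * p * \sum_(j < h) `|al j - a| + 2 * \sum_(j < h) al j * g1 j
       + M ^+ 2 * (1 + 4 * ((1 + A * M) ^+ h) ^+ 2) * (\sum_(j < h) al j) ^+ 2
       + \sum_(j < h) al j * g2 j))
    + a * dot (x 0%N) ((\sum_(j < h) (Q j + (Q j)^T)) *m x 0%N)
    + 2 * \sum_(j < h) al j * dot (x 0%N) (f1 j)
    + (8 * ((1 + A * M) ^+ h) ^+ 2 * h%:R * (1 + A * G) + 1) * forcing h.
Proof.
set x0 := x 0%N; set X := vnorm x0.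
have X0 : 0 <= X := vnorm_ge0 _.
have -> : x h = x0 + (x h - x0) by rewrite addrC subrK.
rewrite vnormD_sqr.
have d2 : vnorm (x h - x0) ^+ 2 <= dr h ^+ 2.
  rewrite lerXn2r ?nnegrE ?vnorm_ge0//; last exact: drift_le.
  exact: le_trans (vnorm_ge0 _) (drift_le (leqnn h)).
have xhE n : x n - x0 =
    \sum_(j < n) (al j *: ((Q j + D j) *m x j) + al j *: (f1 j + f2 j)).
  elim: n => [|n IH]; first by rewrite big_ord0 subrr.
  rewrite big_ord_recr/= -IH xS -!addrA; congr (_ + _).
  by rewrite addrA addrC.
have term (j : 'I_h) : dot x0 (al j *: ((Q j + D j) *m x j) + al j *: (f1 j + f2 j)) <=
    a * dot x0 (Q j *m x0) + `|al j - a| * (p * X ^+ 2) + al j * g1 j * X ^+ 2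
    + al j * (M * X * dr h) + al j * dot x0 (f1 j) + al j * g2 j * X.
  have dj : vnorm (x j - x0) <= dr h by apply: drift_le; exact: ltnW.
  have -> : x j = x0 + (x j - x0) by rewrite addrC subrK.
  rewrite mulmxDr dotDr !dotZr mulmxDl !dotDr.
  have : dot x0 ((Q j + D j) *m (x j - x0)) <= M * X * dr h.
    apply: le_trans (dot_le _ _) _; rewrite [leRHS]mulrAC mulrC ler_wpM2r//.
    apply: le_trans (_ : M * vnorm (x j - x0) <= _); last by rewrite ler_wpM2l.
    rewrite mulmxDl (le_trans (ler_vnormD _ _))//.
    apply: le_trans (lerD (Q_le _ _) (D_le _ _)) _.
    by rewrite -mulrDl ler_wpM2r ?vnorm_ge0.
  have : dot x0 (D j *m x0) <= g1 j * X ^+ 2.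
    apply: le_trans (dot_le _ _) _.
    by rewrite expr2 [leRHS]mulrA [leLHS]mulrC ler_wpM2r.
  have : dot x0 (f2 j) <= g2 j * X.
    by apply: le_trans (dot_le _ _) _; rewrite mulrC ler_wpM2r.
  have : (al j - a) * dot x0 (Q j *m x0) <= `|al j - a| * (p * X ^+ 2).
    apply: le_trans (ler_norm _) _; rewrite normrM ler_wpM2l//.
    apply: le_trans (normr_dot_le _ _) _.
    by rewrite expr2 [leRHS]mulrA [leLHS]mulrC ler_wpM2r.
  have := al_ge0 j.
  move=> a0 H1 /(ler_wpM2l a0) H2 /(ler_wpM2l a0) H3 /(ler_wpM2l a0) H4.
  lra.
have S1 : a * dot x0 ((\sum_(j < h) (Q j + (Q j)^T)) *m x0) =
    2 * \sum_(j < h) a * dot x0 (Q j *m x0).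
  rewrite mulmx_suml (dot_sumr _ _ (fun j => (Q j + (Q j)^T) *m x0)) !mulr_sumr.
  apply: eq_bigr => j _; rewrite mulmxDl dotDr.
  suff -> : dot x0 ((Q j)^T *m x0) = dot x0 (Q j *m x0) by ring.
  have dE u v : dot u v = (u^T *m v) 0 0.
    by rewrite mxE; apply: eq_bigr => i _; rewrite mxE.
  by rewrite dotC !dE trmx_mul trmxK mulmxA.
have S2 := ler_sum (index_enum 'I_h) (fun j (_ : true) => term j).
rewrite -(dot_sumr _ _ (fun j => al j *: ((Q j + D j) *m x j) + al j *: (f1 j + f2 j)))
  -xhE in S2.
rewrite !big_split/= -!mulr_suml in S2.
rewrite S1; have := dr_sqr h; have := forcing_ge0 h.
rewrite -/x0 -/X in S2 d2 *.
move: S2 d2.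
set s1 := \sum_(j < h) a * dot x0 (Q j *m x0); set s2 := \sum_(j < h) `|al j - a|.
set s3 := \sum_(j < h) al j * g1 j; set s := \sum_(j < h) al j.
set s4 := \sum_(j < h) al j * dot x0 (f1 j); set s5 := \sum_(j < h) al j * g2 j.
set K := (_ ^+ h) ^+ 2; set W := forcing h; set r := dr h.
set c := 1 + A * G; set n := h%:R.
have s50 : 0 <= s5 by apply: sumr_ge0 => j _; rewrite mulr_ge0.
have s50W : s5 <= W.
  apply: ler_sum => j _; rewrite lerDr; apply: mulr_ge0; exact: sqr_ge0.
move=> S2 d2 W0 r2.
(* Together with the quadratic term |x h - x 0|^2 this makes two copies of r^2; doubling [dr_sqr]
   gives the constants 4 K and 8 K h (1 + A G). The remaining + 1 in front of [forcing] comes from 2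
   X <= 1 + X^2 below. *)
have : 2 * (s * (M * X * r)) <= M ^+ 2 * s ^+ 2 * X ^+ 2 + r ^+ 2.
  have := sqr_ge0 (M * s * X - r); nra.
have : s5 * (2 * X) <= s5 * (1 + X ^+ 2).
  rewrite ler_wpM2l//; have := sqr_ge0 (X - 1); nra.
nra.
Qed.

End perturbed_linear_recursion.

(** * Integrals over sets of a generated sigma-algebra *)

Section generated_measurability.
Context {R : realType} {d : measure_display} {T : measurableType d}.
Implicit Types (S : set_system T) (f : T -> R).

(** Stated on [g_sigma_algebraType] so that the closure lemmas for [measurable_fun] apply to a
    sub-sigma-algebra. *)
Definition gmeasurable S f :=
  @measurable_fun _ _ (g_sigma_algebraType S) R setT f.

Lemma G_measurableP S f : G_measurable <<s S>> f <-> gmeasurable S f.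
Proof.
split=> [mf _ B mB|mf B mB]; first by rewrite setTI; exact: mf.
by rewrite -(setTI (_ @^-1` _)); apply: mf => //; exact: measurableT.
Qed.

Lemma gen_measurable S : S `<=` measurable -> <<s S>> `<=` measurable.
Proof. by move=> Sm; apply: smallest_sub => //; exact: sigma_algebra_measurable. Qed.

Lemma gmeasurable_fun S f : S `<=` measurable -> gmeasurable S f ->
  measurable_fun setT f.
Proof.
by move=> Sm mf _ B mB; apply: gen_measurable Sm _ _; apply: mf => //; exact: measurableT.
Qed.

Lemma gmeasurableS S S' f : S `<=` S' -> gmeasurable S f -> gmeasurable S' f.
Proof.
move=> SS' mf _ B mB; apply: sub_sigma_algebra2 SS' _ _.
by apply: mf => //; exact: measurableT.
Qed.

Lemma gmeasurable_lt S f (c : R) : gmeasurable S f -> <<s S>> [set x | f x < c].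
Proof.
move=> mf; rewrite (_ : [set x | _] = setT `&` f @^-1` `]-oo, c[%classic).
  by apply: mf => //; exact: measurableT.
by rewrite setTI; apply/seteqP; split => x; rewrite /= in_itv.
Qed.

Lemma gmeasurable_ge S f (c : R) : gmeasurable S f -> <<s S>> [set x | c <= f x].
Proof.
move=> mf; rewrite (_ : [set x | _] = setT `&` f @^-1` `[c, +oo[%classic).
  by apply: mf => //; exact: measurableT.
by rewrite setTI; apply/seteqP; split => x; rewrite /= in_itv/= andbT.
Qed.

Lemma gen_setI S (A B : set T) : <<s S>> A -> <<s S>> B -> <<s S>> (A `&` B).
Proof. exact: (@measurableI _ (g_sigma_algebraType S)). Qed.

Lemma gen_setT S : <<s S>> setT.
Proof. exact: (@measurableT _ (g_sigma_algebraType S)). Qed.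

End generated_measurability.

Section truncated_integrals.
Context {R : realType} {d : measure_display} {T : measurableType d}.
Variable P : probability T R.

Lemma integrableZl_EFin (A : set T) (c : R) (f : T -> R) : measurable A ->
  P.-integrable A (EFin \o f) -> P.-integrable A (EFin \o (fun x => c * f x)).
Proof. by move=> mA /(integrableZl mA c). Qed.

Lemma integrableD_EFin (A : set T) (f g : T -> R) : measurable A ->
  P.-integrable A (EFin \o f) -> P.-integrable A (EFin \o g) ->
  P.-integrable A (EFin \o (fun x => f x + g x)).
Proof. by move=> mA fi gi; have := integrableD mA fi gi. Qed.

Lemma integrable_sum_EFin (A : set T) (I : Type) (r : seq I) (F : I -> T -> R) :
  measurable A -> (forall i, P.-integrable A (EFin \o F i)) ->
  P.-integrable A (EFin \o (fun x => \sum_(i <- r) F i x)).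
Proof.
move=> mA H; elim: r => [|i r IH].
  under [X in _ \o X]eq_fun do rewrite big_nil.
  exact: integrable0.
under [X in _ \o X]eq_fun do rewrite big_cons.
exact: integrableD_EFin.
Qed.

Lemma integrable_bounded_mul (A : set T) (Z D : T -> R) (N : R) :
  measurable A -> measurable_fun A Z -> P.-integrable A (EFin \o D) ->
  (forall x, A x -> `|Z x| <= N) ->
  P.-integrable A (EFin \o (fun x => Z x * D x)).
Proof.
move=> mA mZ iD ZN.
apply: (@le_integrable _ _ _ _ _ mA _ (fun x => N%:E * (EFin \o D) x)%E).
- apply/measurable_EFinP; apply: measurable_funM => //.
  by apply/measurable_EFinP; exact: measurable_int iD.
- move=> x Ax; rewrite /= lee_fin !normrM ler_wpM2r//.
  by apply: le_trans (ZN _ Ax) _; exact: ler_norm.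
- exact: integrableZl.
Qed.

Lemma integrable_bounded (A : set T) (f : T -> R) (N : R) : measurable A ->
  measurable_fun A f -> (forall x, A x -> `|f x| <= N) ->
  P.-integrable A (EFin \o f).
Proof.
move=> mA mf fN.
have i1 : P.-integrable A (EFin \o (fun=> 1)).
  exact: finite_measure_integrable_cst.
have := integrable_bounded_mul mA mf i1 fN.
by under [X in _ \o X]eq_fun do rewrite mulr1.
Qed.

(* Halving: on [{Z >= 0}] and [{Z < 0}] replace [Z] by [Z - N/2] and [Z + N/2];
   the integral is unchanged and the bound on [Z] is divided by 2. *)
Lemma bounded_mul_integral0 (S : set_system T) (D : T -> R) :
  S `<=` measurable -> P.-integrable setT (EFin \o D) ->
  (forall B, <<s S>> B -> \int[P]_(x in B) D x = 0) ->
  forall (A : set T) (Z : T -> R) (N : R), <<s S>> A -> gmeasurable S Z ->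
    (forall x, A x -> `|Z x| <= N) -> \int[P]_(x in A) (Z x * D x) = 0.
Proof.
move=> Sm iD D0.
have mS := gen_measurable Sm.
have iDA (A : set T) : <<s S>> A -> P.-integrable A (EFin \o D).
  by move=> /mS mA; apply: integrableS iD.
have mZT (Z : T -> R) : gmeasurable S Z -> forall A : set T, measurable_fun A Z.
  by move=> /(gmeasurable_fun Sm) mZ A; apply: measurable_funS mZ.
(* [A], [Z] and [N] stay quantified because each halving changes all three. *)
have halve k : forall (A : set T) (Z : T -> R) (N : R), <<s S>> A -> gmeasurable S Z ->
    (forall x, A x -> `|Z x| <= N) ->
    `|\int[P]_(x in A) (Z x * D x)| <= N / 2 ^+ k * \int[P]_(x in A) `|D x|.
  elim: k => [|k IH] A Z N SA SZ ZN.
    rewrite expr0 divr1.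
    have iZD := integrable_bounded_mul (mS _ SA) (mZT _ SZ A) (iDA _ SA) ZN.
    apply: le_trans (le_normr_Rintegral (mS _ SA) iZD) _.
    rewrite -RintegralZl//; [|exact: mS|exact: integrable_norm (iDA _ SA)].
    apply: le_Rintegral => //; [exact: mS|exact: integrable_norm iZD| |].
      by apply: integrableZl_EFin; [exact: mS|exact: integrable_norm (iDA _ SA)].
    by move=> x Ax; rewrite normrM ler_wpM2r// ZN.
  have shift B c : <<s S>> B -> B `<=` A -> (forall x, B x -> `|Z x - c| <= N / 2) ->
      `|\int[P]_(x in B) (Z x * D x)| <= N / 2 ^+ k.+1 * \int[P]_(x in B) `|D x|.
    move=> SB BA Zc.
    have SZc : gmeasurable S (fun x => Z x - c).
      by apply: measurable_funB => //; exact: measurable_cst.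
    have iB := integrable_bounded_mul (mS _ SB) (mZT _ SZc B) (iDA _ SB) Zc.
    have -> : \int[P]_(x in B) (Z x * D x) = \int[P]_(x in B) ((Z x - c) * D x).
      transitivity (\int[P]_(x in B) ((Z x - c) * D x + c * D x)).
        by apply: eq_Rintegral => x _; ring.
      rewrite RintegralD//; [|exact: mS|by apply: integrableZl_EFin; [exact: mS|exact: iDA]].
      by rewrite RintegralZl ?D0 ?mulr0 ?addr0//; [exact: mS|exact: iDA].
    by rewrite exprS invfM mulrA; exact: IH.
  have Ap : <<s S>> (A `&` [set x | 0 <= Z x]).
    by apply: gen_setI => //; exact: gmeasurable_ge.
  have An : <<s S>> (A `&` [set x | Z x < 0]).
    by apply: gen_setI => //; exact: gmeasurable_lt.
  have AE : A = (A `&` [set x | 0 <= Z x]) `|` (A `&` [set x | Z x < 0]).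
    apply/seteqP; split => [x Ax|x []/= []//].
    by case: (leP 0 (Z x)) => Zx; [left|right].
  have dis : [disjoint A `&` [set x | 0 <= Z x] & A `&` [set x | Z x < 0]].
    apply/disj_setPS => x [] [_ /= Z0] [_ /=].
    by rewrite ltNge Z0.
  have iZD := integrable_bounded_mul (mS _ SA) (mZT _ SZ A) (iDA _ SA) ZN.
  rewrite {1 2}AE !Rintegral_setU//; try exact: mS; rewrite -?AE//.
    rewrite mulrDr; apply: le_trans (ler_normD _ _) _; apply: lerD.
      apply: (shift _ (N / 2) Ap (@subIsetl _ _ _)) => x [Ax /= Z0].
      have := ZN x Ax; rewrite !ler_norml => /andP[? ?]; apply/andP; split; lra.
    apply: (shift _ (- (N / 2)) An (@subIsetl _ _ _)) => x [Ax /= Z0].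
    have := ZN x Ax; rewrite !ler_norml => /andP[? ?]; apply/andP; split; lra.
  exact: integrable_norm (iDA _ SA).
move=> A Z N SA SZ ZN; apply/eqP; rewrite -normr_le0.
set I := \int[P]_(x in A) `|D x|.
have cv : (fun k : nat => N * I * (2^-1) ^+ k) @ \oo --> (N * I * 0 : R).
  apply: cvgM; first exact: cvg_cst.
  by apply: cvg_expr; rewrite ger0_norm ?invr_ge0// invf_lt1// ltr1n.
rewrite mulr0 in cv; rewrite -(cvg_lim (@Rhausdorff R) cv).
apply: limr_ge; first by apply/cvg_ex; exists 0.
by apply: nearW => k; rewrite mulrAC exprVn; exact: halve.
Qed.

(** Integrability travels with the sign: [Rintegral] sends an infinite integral to 0, so the sign
    alone would not be stable under sums. *)
Definition nonpos_int (A : set T) (f : T -> R) :=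
  P.-integrable A (EFin \o f) /\ \int[P]_(x in A) f x <= 0.

Lemma nonpos_intD A f g : measurable A -> nonpos_int A f -> nonpos_int A g ->
  nonpos_int A (fun x => f x + g x).
Proof.
move=> mA [fi f0] [gi g0]; split; first exact: integrableD_EFin.
by rewrite RintegralD//; lra.
Qed.

Lemma nonpos_intZ A c f : measurable A -> 0 <= c -> nonpos_int A f ->
  nonpos_int A (fun x => c * f x).
Proof.
move=> mA c0 [fi f0]; split; first exact: integrableZl_EFin.
by rewrite RintegralZl// mulr_ge0_le0.
Qed.

Lemma nonpos_int0 A : measurable A -> nonpos_int A (fun=> 0).
Proof. by move=> mA; split; [exact: integrable0|rewrite Rintegral_cst// mul0r]. Qed.

Lemma nonpos_int_sum (A : set T) (I : Type) (r : seq I) (F : I -> T -> R) :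
  measurable A -> (forall i, nonpos_int A (F i)) ->
  nonpos_int A (fun x => \sum_(i <- r) F i x).
Proof.
move=> mA H; elim: r => [|i r IH].
  under eq_fun do rewrite big_nil.
  exact: nonpos_int0.
under eq_fun do rewrite big_cons.
exact: nonpos_intD.
Qed.

Lemma nonpos_int_ae (A : set T) (f : T -> R) : measurable A ->
  P.-integrable A (EFin \o f) -> (\forall x \ae P, A x -> f x <= 0) -> nonpos_int A f.
Proof.
move=> mA fi f0; split => //.
have mf : measurable_fun A f by apply/measurable_EFinP; exact: measurable_int fi.
have mg : measurable_fun A (fun x => Num.min (f x) 0).
  by apply: measurable_minr => //; exact: measurable_cst.
(* The minimum equals [f] almost everywhere and is nonpositive everywhere, as the pointwise
   comparison [le_Rintegral] requires. *)
have -> : \int[P]_(x in A) f x = \int[P]_(x in A) Num.min (f x) 0.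
  congr fine; apply: ae_eq_integral => //; try exact/measurable_EFinP.
  by apply: filterS f0 => x H Ax /=; congr EFin; apply/esym/min_idPl/H.
apply: (@le_trans _ _ (\int[P]_(x in A) 0)); last by rewrite Rintegral_cst// mul0r.
apply: le_Rintegral => //.
- apply: (le_integrable mA _ _ fi); first exact/measurable_EFinP.
  move=> x _; rewrite /= lee_fin. by case: (leP (f x) 0) => _; rewrite ?normr0 ?lexx ?normr_ge0.
- by rewrite /=; exact: integrable0.
- by move=> x _; rewrite ge_min lexx orbT.
Qed.

Lemma nonpos_int_le0 (A : set T) (f : T -> R) : measurable A -> nonpos_int A f ->
  (\int[P]_(x in A) (f x)%:E <= 0)%E.
Proof.
move=> mA [fi f0]; rewrite -(fineK (integrable_fin_num mA fi)) lee_fin.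
exact: f0.
Qed.

(** [f] is not assumed integrable: it will be the squared norm at the next block, whose integral is
    not yet known to be finite. As [g] may be negative on a null set, it is compared through its
    positive part. *)
Lemma ae_le_integral (A : set T) (f g : T -> R) : measurable A ->
  measurable_fun A f -> (forall x, A x -> 0 <= f x) ->
  P.-integrable A (EFin \o g) -> (\forall x \ae P, A x -> f x <= g x) ->
  (\int[P]_(x in A) (f x)%:E <= \int[P]_(x in A) (g x)%:E)%E.
Proof.
move=> mA mf f0 ig fg.
have mg : measurable_fun A g by apply/measurable_EFinP; exact: measurable_int ig.
have mg0 : measurable_fun A (fun x => Num.max (g x) 0).
  by apply: measurable_maxr => //; exact: measurable_cst.
apply: le_trans (_ : \int[P]_(x in A) (Num.max (g x) 0)%:E <= _)%E.
  apply: ae_ge0_le_integral => //.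
  - exact/measurable_EFinP.
  - by move=> x _; rewrite lee_fin le_max lexx orbT.
  - exact/measurable_EFinP.
  - apply: filterS fg => x H Ax; rewrite lee_fin le_max H//.
rewrite (@ae_eq_integral _ _ _ P A (EFin \o g)) //; try exact/measurable_EFinP.
apply: filterS fg => x H Ax /=; congr EFin; apply/max_idPl.
exact: le_trans (f0 _ Ax) (H Ax).
Qed.

End truncated_integrals.

(** * Almost supermartingales and almost sure convergence *)

Section almost_supermartingale.
Context {R : realType} {d : measure_display} {T : measurableType d}.
Variables (P : probability T R) (S : nat -> set_system T) (V : nat -> T -> R).
Variables (c : nat -> R) (m0 : nat).
Hypothesis Sm : forall n, S n `<=` measurable.
Hypothesis S_S : forall n, S n `<=` S n.+1.
Hypothesis mV : forall n, gmeasurable (S n) (V n).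
Hypothesis V_ge0 : forall n x, 0 <= V n x.
Hypothesis drift : forall m A, (m0 <= m)%N -> <<s S m>> A ->
  (\int[P]_(x in A) (V m.+1 x)%:E <= \int[P]_(x in A) (V m x)%:E + (c m)%:E)%E.

(** The hitting time of level [eps] is encoded by the events that it has not occurred within [k]
    steps, so no stopped process is needed. *)
Let below (eps : R) (n k : nat) :=
  [set x | forall j, (j < k)%N -> V (n + j)%N x < eps].

Let belowS eps n k :
  below eps n k.+1 = below eps n k `&` [set x | V (n + k)%N x < eps].
Proof.
apply/seteqP; split => [x H|x [H1 H2] j].
  by split => [j jk|]; apply: H => //; exact: ltnW.
by rewrite ltnS leq_eqVlt => /predU1P[->//|]; exact: H1.
Qed.

Let gbelow_next eps n k : <<s S (n + k)>> (below eps n k) ->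
  <<s S (n + k)>> (below eps n k.+1).
Proof.
by move=> H; rewrite belowS; apply: gen_setI => //; exact: gmeasurable_lt.
Qed.

Let gbelow eps n k : <<s S (n + k)>> (below eps n k).
Proof.
elim: k => [|k IH].
  rewrite (_ : below _ _ _ = setT); last by apply/seteqP; split.
  exact: gen_setT.
rewrite addnS; apply: (sub_sigma_algebra2 (@S_S _)); exact: gbelow_next.
Qed.

Let mbelow eps n k : measurable (below eps n k).
Proof. by apply: (gen_measurable (@Sm (n + k)%N)); exact: gbelow. Qed.

Let mVT n (A : set T) : measurable_fun A (V n).
Proof.
by apply: (@measurable_funS _ _ _ _ setT) => //; exact: (gmeasurable_fun (@Sm n) (@mV n)).
Qed.

Let mVE n (A : set T) : measurable_fun A (EFin \o V n).
Proof. by apply/measurable_EFinP; exact: mVT. Qed.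

(* Doob's maximal inequality with an additive defect, by induction on the
   length of the window. *)
Let maximal (eps : R) n k : 0 < eps -> (m0 <= n)%N ->
  (eps%:E * P (~` below eps n k) + \int[P]_(x in below eps n k) (V (n + k) x)%:E
   <= \int[P]_x (V n x)%:E + (\sum_(j < k) c (n + j))%:E)%E.
Proof.
move=> e0 m0n; elim: k => [|k IH].
  rewrite (_ : below _ _ _ = setT); last by apply/seteqP; split.
  by rewrite setCT measure0 mule0 add0e big_ord0 adde0 addn0.
rewrite big_ord_recr/= EFinD [leRHS]addeA.
apply: (le_trans _ (leeD2r _ IH)) => {IH}.
rewrite addnS.
have nk : (m0 <= n + k)%N by apply: leq_trans m0n _; exact: leq_addr.
have dr : (\int[P]_(x in below eps n k.+1) (V (n + k).+1 x)%:E <=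
    \int[P]_(x in below eps n k.+1) (V (n + k)%N x)%:E + (c (n + k)%N)%:E)%E.
  by apply: drift => //; apply: gbelow_next; exact: gbelow.
apply: le_trans (leeD2l (eps%:E * P (~` below eps n k.+1)) dr) _.
rewrite [leLHS]addeA leeD2r//.
set H := below eps n k; set H' := below eps n k.+1.
have mH : measurable H by exact: mbelow.
have mH' : measurable H' by exact: mbelow.
have H'H : H' `<=` H by rewrite /H' belowS; exact: subIsetl.
(* A first crossing at time n + k lies in H \ H', where eps <= V (n + k); its probability times
   [eps] is paid for by the part of the integral lost from H to H'. *)
have -> : ~` H' = ~` H `|` (H `\` H').
  apply/seteqP; split => [x nx|x [nHx /H'H//|[]//]].
  by case: (pselect (H x)) => Hx; [right|left].
rewrite measureU//; [|exact: measurableC|exact: measurableD|]; last first.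
  by apply/seteqP; split => // x [nHx []].
rewrite muleDr//; last by rewrite ge0_adde_def// inE measure_ge0.
rewrite -addeA leeD2l//.
rewrite -[in leRHS](setDUK H'H) ge0_integral_setU//=; last 4 first.
- exact: measurableD.
- exact: mVE.
- by move=> x _; rewrite lee_fin.
- by rewrite disj_set2E setDIK.
rewrite addeC leeD2l// -integral_cst//; last exact: measurableD.
apply: ge0_le_integral => //.
- exact: measurableD.
- by move=> x _; rewrite lee_fin ltW.
- exact: mVE.
- move=> x [Hx]; rewrite /H' belowS => nx; rewrite lee_fin leNgt.
  by apply/negP => lt; apply: nx; split.
Qed.

Let above eps n := \bigcup_k ~` below eps n k.

Let mabove eps n : measurable (above eps n).
Proof. by apply: bigcupT_measurable => k; apply: measurableC; exact: mbelow. Qed.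

Let above_le eps n (b : R) : 0 < eps -> (m0 <= n)%N ->
  (forall k, (\int[P]_x (V n x)%:E + (\sum_(j < k) c (n + j))%:E <= (eps * b)%:E)%E) ->
  (P (above eps n) <= b%:E)%E.
Proof.
move=> e0 m0n H.
have cv : P \o (fun k => ~` below eps n k) @ \oo --> P (above eps n).
  apply: nondecreasing_cvg_mu.
  - by move=> i; apply: measurableC; exact: mbelow.
  - exact: mabove.
  - apply/nondecreasing_seqP => k; apply/subsetPset/subsetC.
    by rewrite belowS; exact: subIsetl.
rewrite -(cvg_lim _ cv)//; apply: lime_le; first by apply/cvg_ex; eexists; exact: cv.
apply: nearW => k /=; rewrite -(@lee_pmul2l _ eps%:E)// -EFinM.
apply: le_trans (H k); apply: le_trans (maximal k e0 m0n).
by apply: leeDl; apply: integral_ge0 => x _; rewrite lee_fin.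
Qed.

(** If V fails to tend to 0 at x, some level 1/(i+1) is reached after every n. Starting at an n
    where mean plus tail of defects is at most b/(i+1), the maximal inequality bounds this event by
    b, for every b > 0. *)
Lemma almost_supermartingale_cvg0 :
  (forall eta : R, 0 < eta -> exists2 n, (m0 <= n)%N & forall k,
     (\int[P]_x (V n x)%:E + (\sum_(j < k) c (n + j))%:E <= eta%:E)%E) ->
  \forall x \ae P, V ^~ x @ \oo --> 0.
Proof.
move=> small; have io0 (i : nat) :
    \forall x \ae P, ~ (\bigcap_n above (i.+1%:R^-1) n) x.
  exists (\bigcap_n above (i.+1%:R^-1) n); split.
  - by apply: bigcapT_measurable => n; exact: mabove.
  - apply/eqP; rewrite eq_le measure_ge0 andbT.
    apply/lee_addgt0Pr => b b0; rewrite add0e.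
    have e0 : (0 : R) < i.+1%:R^-1 by rewrite invr_gt0 ltr0n.
    have [n m0n Hn] := small (i.+1%:R^-1 * b) (mulr_gt0 e0 b0).
    apply: le_trans (above_le e0 m0n Hn).
    apply: le_measure; rewrite ?inE; last exact: bigcap_inf.
      by apply: bigcapT_measurable => j; exact: mabove.
    exact: mabove.
  - by move=> x /= /contrapT.
apply: filterS (ae_foralln io0) => x Hx.
apply/cvgr0Pnorm_lt => e e0.
have [i ie] : exists i : nat, i.+1%:R^-1 < e.
  exists (Num.trunc e^-1); rewrite -[ltRHS]invrK ltf_pV2 ?posrE ?invr_gt0 ?ltr0n//.
  by rewrite truncnS_gt.
have : exists n, ~ above (i.+1%:R^-1) n x.
  by apply: contrapT => /forallNP nH; apply: (Hx i) => n _; apply: contrapT; exact: nH.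
move=> [n nab]; exists n => // m /= nm.
rewrite ger0_norm//; apply: lt_trans ie; rewrite ltNge; apply/negP => le.
apply: nab; exists (m - n).+1 => // /(_ (m - n)%N (ltnSn _)).
by rewrite subnKC// ltNge le.
Qed.

End almost_supermartingale.

(** * Step sizes *)

Section step_sizes.
Context {R : realType}.

Lemma cvg_sum_ord (h : nat) (f : nat -> nat -> R) (l : nat -> R) :
  (forall j, f j @ \oo --> l j) ->
  (fun n => \sum_(j < h) f j n) @ \oo --> \sum_(j < h) l j.
Proof.
move=> fl; elim: h => [|h IH].
  under eq_fun do rewrite big_ord0; rewrite big_ord0; exact: cvg_cst.
under eq_fun do rewrite big_ord_recr/=; rewrite big_ord_recr/=.
exact: cvgD.
Qed.

Lemma cvg_shift_add (u : nat -> R) (l : R) (j : nat) :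
  u @ \oo --> l -> (fun n => u (n + j)%N) @ \oo --> l.
Proof. by rewrite cvg_shiftn. Qed.

(** Once k/2 times the tolerance dominates [r], the excess of [v] over half the tolerance is
    contracted without remainder, and the divergent sum of [s] drives it down. *)
Lemma contraction_cvg0 (v s r : nat -> R) (k : R) (m0 : nat) :
  0 < k -> (forall m, 0 <= v m) -> (forall m, 0 <= s m) ->
  (forall m, (m0 <= m)%N -> k * s m <= 1) ->
  (forall m, (m0 <= m)%N -> v m.+1 <= (1 - k * s m) * v m + s m * r m) ->
  r @ \oo --> 0 -> (fun n => \sum_(m < n) s m) @ \oo --> +oo ->
  v @ \oo --> 0.
Proof.
move=> k0 v0 s0 ks1 rec r0 sy; apply/cvgr0Pnorm_le => e e0.
have e2 : 0 < e / 2 by rewrite divr_gt0.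
have /cvgr0Pnorm_le /(_ _ (mulr_gt0 k0 e2)) [m1 _ Hr] := r0.
set M := maxn m0 m1.
have [m0M m1M] : (m0 <= M)%N /\ (m1 <= M)%N by split; rewrite ?leq_maxl ?leq_maxr.
pose u m := Num.max (v m - e / 2) 0.
have u0 m : 0 <= u m by rewrite le_max lexx orbT.
have uS m : (M <= m)%N -> u m.+1 <= (1 - k * s m) * u m.
  move=> Mm; have m0m := leq_trans m0M Mm; have m1m := leq_trans m1M Mm.
  have t0 : 0 <= 1 - k * s m by rewrite subr_ge0 ks1.
  rewrite ge_max mulr_ge0// andbT.
  apply: (@le_trans _ _ ((1 - k * s m) * (v m - e / 2))); last first.
    by rewrite ler_wpM2l// le_max lexx.
  have := rec _ m0m; have := Hr _ m1m => /=; rewrite ler_norml => /andP[_].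
  move=> /(ler_wpM2l (s0 m)); lra.
(* Replaces the infinite product of the factors 1 - k s: for x, y >= 0, (1 - x)(1 + y + x) <= 1 + y,
   the dropped term being x (x + y). *)
have usum j : u (M + j)%N * (1 + k * \sum_(i < j) s (M + i)%N) <= u M.
  elim: j => [|j IH]; first by rewrite big_ord0 mulr0 addr0 mulr1 addn0.
  apply: le_trans IH; rewrite big_ord_recr/= addnS.
  have S0 : 0 <= \sum_(i < j) s (M + i)%N by exact: sumr_ge0.
  have Mj : (M <= M + j)%N by exact: leq_addr.
  move: (uS _ Mj) (s0 (M + j)%N) (u0 (M + j)%N) S0.
  set S := \sum_(_ < _) _; set t := s _; set a := u (M + j)%N.
  set b := u _ => ba t0 a0 S0.
  have c0 : 0 <= 1 + k * (S + t).
    by apply: addr_ge0 => //; apply: mulr_ge0; [exact: ltW|exact: addr_ge0].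
  apply: le_trans (ler_wpM2r c0 ba) _.
  have : 0 <= a * ((k * t) * (k * (S + t))).
    by rewrite !mulr_ge0// ?addr_ge0// ltW.
  lra.
(* Chosen so that k times the sum from M on is at least u M / (e/2); [usum] then forces u n <=
   e/2. *)
move/cvgryPge : sy => /(_ (\sum_(i < M) s i + k^-1 * (u M / (e / 2)))) [N _ HN].
exists (maxn M N) => // n /=; rewrite geq_max => /andP[Mn Nn].
rewrite ger0_norm//.
have := HN n Nn; have := usum (n - M)%N; rewrite subnKC//.
have -> : \sum_(i < n) s i = \sum_(i < M) s i + \sum_(i < n - M) s (M + i)%N.
  have sp j : \sum_(i < M + j) s i = \sum_(i < M) s i + \sum_(i < j) s (M + i)%N.
    by rewrite big_split_ord.
  by have := sp (n - M)%N; rewrite subnKC.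
rewrite lerD2l => H1 H2.
have vu : v n <= u n + e / 2 by rewrite -lerBlDr le_max lexx.
suff : u n <= e / 2 by lra.
rewrite leNgt; apply/negP => ue.
move: H2; rewrite mulrC ler_pdivrMr// => H2.
have : u n * (1 + u M / (e / 2)) <= u M.
  by apply: le_trans H1; rewrite ler_wpM2l// lerD2l [leRHS]mulrC.
have : e / 2 * (1 + u M / (e / 2)) < u n * (1 + u M / (e / 2)).
  by rewrite ltr_pM2r// ltr_pwDl// divr_ge0// ltW.
rewrite mulrDr mulr1 mulrCA divff ?gt_eqF// mulr1.
lra.
Qed.

Variables (alpha : nat -> R).
Hypothesis alpha_gt0 : forall t, 0 < alpha t.
Hypothesis alpha_cvg0 : alpha @ \oo --> 0.

(** alpha(t)/alpha(t+1) = 1 + alpha(t) (1/alpha(t+1) - 1/alpha(t)) tends to 1 + 0 alpha0; longer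
    shifts are products of such ratios. *)
Lemma step_ratio_cvg1 (alpha0 : R) :
  (fun t => (alpha t.+1)^-1 - (alpha t)^-1) @ \oo --> alpha0 ->
  forall j, (fun t => alpha (t + j)%N / alpha t) @ \oo --> (1 : R).
Proof.
move=> cv.
have an0 t : alpha t != 0 by rewrite gt_eqF.
have r1 : (fun t => alpha t.+1 / alpha t) @ \oo --> (1 : R).
  have : (fun t => 1 + alpha t * ((alpha t.+1)^-1 - (alpha t)^-1)) @ \oo --> 1 + 0 * alpha0.
    by apply: cvgD; [exact: cvg_cst|exact: cvgM].
  rewrite mul0r addr0 => /cvgV; rewrite oner_eq0 invr1 => /(_ isT).
  apply: cvg_trans; apply: near_eq_cvg; apply: nearW => t /=.
  by rewrite mulrBr divff// addrC subrK invf_div.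
elim=> [|j IH].
  under eq_fun do rewrite addn0 divff//; exact: cvg_cst.
have : (fun t => (alpha (t + j).+1 / alpha (t + j)%N) * (alpha (t + j)%N / alpha t))
    @ \oo --> (1 * 1 : R).
  by apply: cvgM; [exact: (cvg_shift_add j r1)|exact: IH].
rewrite mulr1.
apply: cvg_trans; apply: near_eq_cvg; apply: nearW => t /=.
by rewrite addnS mulrA divfK.
Qed.

(** The left side is the error coefficient of [perturbed_block_le]. Divided by alpha n, each of its
    terms acquires a factor tending to 0, while the sum of the ratios tends to h < 2h. *)
Lemma step_coefficients_small (alpha0 p K l : R) (g1 g2 : nat -> R) (h : nat) :
  (0 < h)%N -> 0 < l ->
  (fun t => (alpha t.+1)^-1 - (alpha t)^-1) @ \oo --> alpha0 ->
  g1 @ \oo --> 0 -> g2 @ \oo --> 0 ->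
  \forall n \near \oo,
    (2 * p * (\sum_(j < h) `|alpha (n + j)%N - alpha n|)
     + 2 * (\sum_(j < h) alpha (n + j)%N * g1 (n + j)%N)
     + K * (\sum_(j < h) alpha (n + j)%N) ^+ 2
     + \sum_(j < h) alpha (n + j)%N * g2 (n + j)%N <= l * alpha n) /\
    (\sum_(j < h) alpha (n + j)%N <= 2 * h%:R * alpha n) /\ l * alpha n <= 1.
Proof.
move=> h0 l0 /step_ratio_cvg1 ratio g10 g20.
pose q j n := alpha (n + j)%N / alpha n.
have qE j n : alpha (n + j)%N = q j n * alpha n by rewrite /q divfK// gt_eqF.
pose rho n := 2 * p * (\sum_(j < h) `|q j n - 1|)
     + 2 * (\sum_(j < h) q j n * g1 (n + j)%N)
     + K * (\sum_(j < h) q j n) * (\sum_(j < h) alpha (n + j)%N)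
     + \sum_(j < h) q j n * g2 (n + j)%N.
have sumq : (fun n => \sum_(j < h) q j n) @ \oo --> (h%:R : R).
  have := @cvg_sum_ord h q (fun=> 1) ratio.
  by rewrite sumr_const card_ord.
have sum0 (f : nat -> nat -> R) : (forall j, f j @ \oo --> 0) ->
    (fun n => \sum_(j < h) f j n) @ \oo --> (0 : R).
  by move=> /(@cvg_sum_ord h f (fun=> 0)); rewrite big1.
have rho0 : rho @ \oo --> 0.
  have -> : (0 : R) = 2 * p * 0 + 2 * 0 + K * h%:R * 0 + 0 by ring.
  apply: cvgD; [apply: cvgD; [apply: cvgD|]|].
  - apply: cvgM; first exact: cvg_cst.
    apply: (sum0 (fun j n => `|q j n - 1|)) => j.
    have H : (fun n => q j n - 1) @ \oo --> (1 - 1 : R).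
      by apply: cvgB; [exact: ratio|exact: cvg_cst].
    rewrite subrr in H; have := cvg_norm H; rewrite normr0; exact.
  - apply: cvgM; first exact: cvg_cst.
    apply: (sum0 (fun j n => q j n * g1 (n + j)%N)) => j.
    rewrite -(mulr0 1); apply: cvgM; first exact: ratio.
    exact: cvg_shift_add.
  - apply: cvgM.
      by apply: cvgM; [exact: cvg_cst|exact: sumq].
    by apply: (sum0 (fun j n => alpha (n + j)%N)) => j; exact: cvg_shift_add.
  - apply: (sum0 (fun j n => q j n * g2 (n + j)%N)) => j.
    rewrite -(mulr0 1); apply: cvgM; first exact: ratio.
    exact: cvg_shift_add.
have hlt : (h%:R : R) < 2 * h%:R by rewrite ltr_pMl ?ltr1n// ltr0n.
have H1 := cvgr_le _ rho0 _ l0; have H2 := cvgr_le _ sumq _ hlt.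
have l1 : 0 < l^-1 by rewrite invr_gt0.
have H3 := cvgr_le _ alpha_cvg0 _ l1.
near=> n; have a0 := alpha_gt0 n.
split; last split.
- rewrite [leLHS](_ : _ = rho n * alpha n).
    by rewrite ler_pM2r//; near: n; exact: H1.
  have E1 : \sum_(j < h) `|alpha (n + j)%N - alpha n| =
      (\sum_(j < h) `|q j n - 1|) * alpha n.
    rewrite mulr_suml; apply: eq_bigr => j _.
    by rewrite qE -{2}(mul1r (alpha n)) -mulrBl normrM (gtr0_norm a0).
  have E2 (g : nat -> R) : \sum_(j < h) alpha (n + j)%N * g (n + j)%N =
      (\sum_(j < h) q j n * g (n + j)%N) * alpha n.
    by rewrite mulr_suml; apply: eq_bigr => j _; rewrite qE; ring.
  have E3 : \sum_(j < h) alpha (n + j)%N = (\sum_(j < h) q j n) * alpha n.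
    by rewrite mulr_suml; apply: eq_bigr => j _; exact: qE.
  by rewrite E1 !E2 /rho expr2 {1}E3; ring.
- under eq_bigr do rewrite qE.
  rewrite -mulr_suml ler_pM2r//; near: n; exact: H2.
- rewrite -ler_pdivlMl ?mulr1//; near: n; exact: H3.
Unshelve. all: by end_near.
Qed.

End step_sizes.

Lemma sum_blocks {R : realType} (f : nat -> R) (h m k : nat) :
  \sum_(j < k) \sum_(i < h) f ((m + j) * h + i)%N =
  \sum_(i < k * h) f (m * h + i)%N.
Proof.
elim: k => [|k IH]; first by rewrite !big_ord0.
rewrite big_ord_recr/= IH mulSnr big_split_ord/=; congr (_ + _).
by apply: eq_bigr => i _; rewrite mulnDl addnA.
Qed.

Lemma powR_cvg0_base {R : realType} (u : nat -> R) (p : R) :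
  0 < p -> (forall n, 0 <= u n) -> u @ \oo --> 0 ->
  (fun n => u n `^ p) @ \oo --> 0.
Proof.
move=> p0 u0 /cvgr0Pnorm_le H; apply/cvgr0Pnorm_le => e e0.
have e1 : 0 < e `^ p^-1 by exact: powR_gt0.
apply: filterS (H _ e1) => n; rewrite !ger0_norm ?powR_ge0// => un.
have -> : e = (e `^ p^-1) `^ p by rewrite -powRrM mulVf ?gt_eqF// powRr1// ltW.
by apply: ge0_ler_powR; rewrite ?nnegrE ?powR_ge0//; exact: ltW.
Qed.

Lemma summable_tail_le {R : realType} (b : nat -> R) : (forall t, 0 <= b t) ->
  (\sum_(1 <= t <oo) (b t)%:E < +oo)%E ->
  forall eta : R, 0 < eta ->
    \forall n \near \oo, forall k, \sum_(j < k) b (n + j)%N <= eta.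
Proof.
move=> b0 bS eta eta0.
pose u n := \sum_(1 <= t < n) b t.
have u_S n k : u (n.+1 + k)%N = u n.+1 + \sum_(j < k) b (n.+1 + j)%N.
  elim: k => [|k IH]; first by rewrite big_ord0 addr0 addn0.
  by rewrite addnS /u big_nat_recr/= ?addSn// -addSn -/(u _) IH big_ord_recr/= addrA.
have ufin n : ((u n)%:E <= \sum_(1 <= t <oo) (b t)%:E)%E.
  by rewrite -sumEFin; apply: nneseries_lim_ge => i _; rewrite lee_fin.
set B := (\sum_(1 <= t <oo) (b t)%:E)%E in bS ufin.
have B0 : (0 <= B)%E by apply: nneseries_ge0 => i _ _; rewrite lee_fin.
have Bfin : B \is a fin_num by rewrite ge0_fin_numE.
have ucv : cvgn u.
  apply: nondecreasing_is_cvgn.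
    apply/nondecreasing_seqP => -[|n]; rewrite /u.
      by rewrite !big_geq.
    by rewrite [leRHS]big_nat_recr//= lerDl.
  by exists (fine B) => _ [n _ <-]; rewrite -lee_fin fineK.
have e2 : 0 < eta / 2 by rewrite divr_gt0.
have /cvgrPdist_le /(_ _ e2) [N _ HN] := ucv.
(* The shift keeps the index positive: the series starts at 1, so [b 0] is not controlled by it. *)
exists N.+1 => // -[//|n] /= Nn k.
have H1 := HN n.+1 (ltnW Nn).
have H2 := HN (n.+1 + k)%N (leq_trans (ltnW Nn) (leq_addr _ _)).
move: H1 H2; rewrite /= u_S !ler_norml => /andP[? ?] /andP[? ?]; lra.
Qed.

(** Countably many tolerances exhibit the convergence event as a countable combination of coordinate
    events, hence as measurable. *)
Lemma cV_cvg0P {R : realType} {q : nat} (x : nat -> 'cV[R]_q) :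
  x @ \oo --> (0 : 'cV[R]_q) <->
  forall i : nat, exists N, forall n, (N <= n)%N ->
    forall k, `|x n k 0| < i.+1%:R^-1.
Proof.
split=> [/cvg_ballP H i|H].
  have i0 : (0 : R) < i.+1%:R^-1 by rewrite invr_gt0 ltr0n.
  have [N _ HN] := H _ i0; exists N => n /HN /= [_ xn] k.
  by have := xn k 0; rewrite /ball/= mxE sub0r normrN.
apply/cvg_ballP => eps eps0.
have [i ieps] : exists i : nat, i.+1%:R^-1 < eps.
  exists (Num.truncn eps^-1); rewrite -[ltRHS]invrK ltf_pV2 ?posrE ?invr_gt0 ?ltr0n//.
  exact: truncnS_gt.
have [N HN] := H i; exists N => // n /= Nn; split => // k j.
rewrite ord1 /ball/= mxE sub0r normrN; apply: lt_trans ieps; exact: HN.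
Qed.

(** * The random recursion: block inequality and mean square convergence *)

Section recursion.
Context {R : realType} {d : measure_display} {T : measurableType d}.
Variables (P : probability T R) (q : nat) (alpha : nat -> R).
Variables (Q Delta : nat -> T -> 'M[R]_q) (eps1 eps2 : nat -> T -> 'cV[R]_q).
Variables (e0 : 'cV[R]_q) (e : nat -> T -> 'cV[R]_q).
Variables (h : nat) (lambda pi1 c_eps delta : R) (g1 g2 : nat -> R).
Variables (alpha0 A0 G1 G2 : R).
Hypothesis mQ : forall t (i j : 'I_q), measurable_fun setT (fun w => Q t w i j).
Hypothesis mDelta :
  forall t (i j : 'I_q), measurable_fun setT (fun w => Delta t w i j).
Hypothesis meps1 : forall t (i : 'I_q), measurable_fun setT (fun w => eps1 t w i 0).
Hypothesis e_0 : forall w, e 0%N w = e0.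
Hypothesis e_S : forall t w, e t.+1 w = e t w
  + alpha t *: ((Q t w + Delta t w) *m e t w) + alpha t *: (eps1 t w + eps2 t w).
Hypothesis alpha_gt0 : forall t, 0 < alpha t.
Hypothesis alpha_le : forall t, alpha t <= A0.
Hypothesis alpha_cvg0 : alpha @ \oo --> 0.
Hypothesis alpha_sum : (fun n => \sum_(0 <= t < n) alpha t) @ \oo --> +oo.
Hypothesis alpha_inv :
  (fun t => (alpha t.+1)^-1 - (alpha t)^-1) @ \oo --> alpha0.
Hypothesis Q_le : \forall w \ae P, forall t, opnorm (Q t w) <= pi1.
Hypothesis h_gt0 : (0 < h)%N.
Hypothesis lambda_gt0 : 0 < lambda.
Hypothesis Q_stable : forall m : nat, exists Y : T -> 'M[R]_q,
  (forall i j : 'I_q,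
    is_cond_exp P (Fpast Q Delta eps1 (m * h))
      (fun w => (\sum_(m * h <= t < m.+1 * h) (Q t w + (Q t w)^T)) i j)
      (fun w => Y w i j)) /\
  (\forall w \ae P, lambda_max (Y w) <= - lambda).
Hypothesis Delta_le : \forall w \ae P, forall t, opnorm (Delta t w) <= g1 t.
Hypothesis g1_cvg0 : g1 @ \oo --> 0.
Hypothesis g1_le : forall t, g1 t <= G1.
Hypothesis eps1_mds : mds P (Fpast Q Delta eps1) eps1.
Hypothesis c_eps_gt0 : 0 < c_eps.
Hypothesis delta_lt : delta < 1 / 2.
Hypothesis eps1_var : forall t, exists Y : T -> R,
  is_cond_exp P (Fpast Q Delta eps1 t)
    (fun w => vnorm ((alpha t `^ delta) *: eps1 t w) ^+ 2) Y /\
  (\forall w \ae P, Y w <= c_eps).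
Hypothesis meps2 : forall t (i : 'I_q),
  G_measurable (Fpast Q Delta eps1 t.+1) (fun w => eps2 t w i 0).
Hypothesis eps2_le : \forall w \ae P, forall t, vnorm (eps2 t w) <= g2 t.
Hypothesis g2_cvg0 : g2 @ \oo --> 0.
Hypothesis g2_le : forall t, g2 t <= G2.

(** The generators inside [Fpast], named so that [Fpast Q Delta eps1 t] is [<<s gen t>>] by
    conversion and the lemmas on generated sigma-algebras apply. *)
Let gen (t : nat) : set_system T :=
  [set A | exists s (i j : 'I_q) (B : set R),
     (s < t)%N /\ measurable B /\
     [\/ A = (fun w => Q s w i j) @^-1` B,
         A = (fun w => Delta s w i j) @^-1` B |
         A = (fun w => eps1 s w i 0) @^-1` B]].

Let gen_m t : gen t `<=` measurable.
Proof.
move=> _ [s [i [j [B [_ [mB [->|->|->]]]]]]]; rewrite -[X in measurable X]setTI.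
- exact: mQ.
- exact: mDelta.
- exact: meps1.
Qed.

Let gen_le s t : (s <= t)%N -> gen s `<=` gen t.
Proof.
move=> st A [u [i [j [B [us H]]]]]; exists u, i, j, B.
by split => //; exact: leq_trans st.
Qed.

Let genF t A : <<s gen t>> A -> measurable A.
Proof. by apply: gen_measurable; exact: gen_m. Qed.

Let genF_le s t A : (s <= t)%N -> <<s gen s>> A -> <<s gen t>> A.
Proof. by move=> st; apply: sub_sigma_algebra2; exact: gen_le. Qed.

Let gQ t i j : gmeasurable (gen t.+1) (fun w => Q t w i j).
Proof.
apply/G_measurableP => B mB; apply: sub_sigma_algebra.
by exists t, i, j, B; split => //; split => //; constructor 1.
Qed.

Let gDelta t i j : gmeasurable (gen t.+1) (fun w => Delta t w i j).
Proof.
apply/G_measurableP => B mB; apply: sub_sigma_algebra.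
by exists t, i, j, B; split => //; split => //; constructor 2.
Qed.

Let geps1 t i : gmeasurable (gen t.+1) (fun w => eps1 t w i 0).
Proof. by apply/G_measurableP; exact: (eps1_mds t i).1. Qed.

Let geps2 t i : gmeasurable (gen t.+1) (fun w => eps2 t w i 0).
Proof. by apply/G_measurableP; exact: meps2. Qed.

(** Predictability: e(t) is built from the data before time t, so eps'(t) is centred against it. *)
Let ge t i : gmeasurable (gen t) (fun w => e t w i 0).
Proof.
elim: t i => [|t IH] i.
  by under eq_fun do rewrite e_0; exact: measurable_cst.
have IH' j : gmeasurable (gen t.+1) (fun w => e t w j 0).
  by apply: gmeasurableS (IH j); exact: gen_le.
rewrite (_ : (fun w => _) = fun w => e t w i 0
  + alpha t * (\sum_j (Q t w i j + Delta t w i j) * e t w j 0)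
  + alpha t * (eps1 t w i 0 + eps2 t w i 0)); last first.
  apply/funext => w; rewrite e_S !mxE; congr (_ + _ * _ + _).
  by apply: eq_bigr => j _; rewrite !mxE.
apply: measurable_funD; first apply: measurable_funD; first exact: IH'.
- apply: measurable_funM; first exact: measurable_cst.
  apply: measurable_sum => j; apply: measurable_funM; last exact: IH'.
  by apply: measurable_funD; [exact: gQ|exact: gDelta].
- apply: measurable_funM; first exact: measurable_cst.
  by apply: measurable_funD; [exact: geps1|exact: geps2].
Qed.

Let gdot S (u v : T -> 'cV[R]_q) :
  (forall i, gmeasurable S (fun w => u w i 0)) ->
  (forall i, gmeasurable S (fun w => v w i 0)) ->
  gmeasurable S (fun w => dot (u w) (v w)).
Proof.
move=> gu gv; apply: measurable_sum => i.
by apply: measurable_funM; [exact: gu|exact: gv].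
Qed.

Let gV t : gmeasurable (gen t) (fun w => vnorm (e t w) ^+ 2).
Proof. by under eq_fun do rewrite vnorm_sqr; apply: gdot => i; exact: ge. Qed.

Let gN t : gmeasurable (gen t.+1) (fun w => alpha t ^+ 2 * vnorm (eps1 t w) ^+ 2).
Proof.
apply: measurable_funM; first exact: measurable_cst.
by under eq_fun do rewrite vnorm_sqr; apply: gdot => i; exact: geps1.
Qed.

Let mgen S (A : set T) (f : T -> R) : S `<=` measurable -> gmeasurable S f ->
  measurable_fun A f.
Proof.
by move=> Sm gf; apply: (@measurable_funS _ _ _ _ setT) => //; exact: gmeasurable_fun gf.
Qed.

Let mV t A : measurable_fun A (fun w => vnorm (e t w) ^+ 2).
Proof. exact: mgen (@gen_m t) (@gV t). Qed.

Let mN t A : measurable_fun A (fun w => alpha t ^+ 2 * vnorm (eps1 t w) ^+ 2).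
Proof. exact: mgen (@gen_m t.+1) (@gN t). Qed.

(** A single almost sure event on which the pathwise estimates hold in every block at once. *)
Let tame w := [/\ forall t v, vnorm (Q t w *m v) <= pi1 * vnorm v,
  forall t v, vnorm (Delta t w *m v) <= g1 t * vnorm v &
  forall t, vnorm (eps2 t w) <= g2 t].

Let tame_ae : \forall w \ae P, tame w.
Proof.
near=> w; split.
- move=> t v; apply: le_trans (vnorm_mulmx_le _ _) _; apply: ler_wpM2r.
    exact: vnorm_ge0.
  by move: t; near: w; exact: Q_le.
- move=> t v; apply: le_trans (vnorm_mulmx_le _ _) _; apply: ler_wpM2r.
    exact: vnorm_ge0.
  by move: t; near: w; exact: Delta_le.
- by near: w; exact: eps2_le.
Unshelve. all: by end_near.
Qed.

(** One good outcome suffices to read off the signs of the deterministic bounds [pi1], [g1] and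
    [g2], which are not assumed. *)
Let ae_exists (p : T -> Prop) : (\forall w \ae P, p w) -> exists w, p w.
Proof.
move=> H; have pf : ProperFilter (almost_everywhere P).
  apply: ae_properfilter_algebraOfSetsType.
  by rewrite [X in (_ < X)%E](probability_setT P) lte01.
exact: filter_ex H.
Qed.

Let pi1_ge0 : 0 <= pi1.
Proof.
have [w H] := ae_exists Q_le; exact: le_trans (opnorm_ge0 _) (H 0%N).
Qed.

Let g1_ge0 t : 0 <= g1 t.
Proof.
have [w H] := ae_exists Delta_le; exact: le_trans (opnorm_ge0 _) (H t).
Qed.

Let g2_ge0 t : 0 <= g2 t.
Proof.
have [w H] := ae_exists eps2_le; exact: le_trans (vnorm_ge0 _) (H t).
Qed.

(** What remains of alpha^2 once alpha^(2 delta) has been absorbed into the conditional variance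
    bound. *)
Let beta t := alpha t `^ (2 * (1 - delta)).
Let b t := beta t * c_eps + alpha t * g2 t.

Let b_ge0 t : 0 <= b t.
Proof. by rewrite addr_ge0// mulr_ge0 ?powR_ge0// ltW. Qed.

(** As delta < 1/2, the second factor tends to 0: the noise injected per step is o(alpha). *)
Let betaE t : beta t = alpha t * alpha t `^ (1 - 2 * delta).
Proof.
rewrite /beta -{2}(powRr1 (ltW (alpha_gt0 t))) -powRD; last first.
  by apply/implyP => _; rewrite gt_eqF.
by congr powR; lra.
Qed.

Let beta_sqr t : alpha t ^+ 2 = beta t * (alpha t `^ delta) ^+ 2.
Proof.
rewrite -!powR_mulrn ?powR_ge0// ?ltW// -powRrM -powRD; last first.
  by apply/implyP => _; rewrite gt_eqF.
by congr powR; lra.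
Qed.

Let nonpos_int_noise t A : <<s gen t>> A ->
  nonpos_int P A (fun w => alpha t ^+ 2 * vnorm (eps1 t w) ^+ 2 - beta t * c_eps).
Proof.
move=> FA; have mA := genF FA.
have [Y [[iX [_ [iY XY]]] Yc]] := eps1_var t.
rewrite (_ : (fun w => _) = fun w => beta t *
    (vnorm ((alpha t `^ delta) *: eps1 t w) ^+ 2 + - c_eps)); last first.
  apply/funext => w; rewrite beta_sqr vnormZ ger0_norm ?powR_ge0//; ring.
apply: nonpos_intZ => //; first exact: powR_ge0.
have iXA : P.-integrable A (EFin \o
    (fun w => vnorm ((alpha t `^ delta) *: eps1 t w) ^+ 2)).
  exact: integrableS iX.
have iYA : P.-integrable A (EFin \o Y) by exact: integrableS iY.
have icA : P.-integrable A (EFin \o (fun=> - c_eps)).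
  exact: finite_measure_integrable_cst.
split; first exact: (integrableD_EFin mA iXA icA).
rewrite (RintegralD mA iXA icA).
rewrite {1}/Rintegral XY// -/(Rintegral P A Y) -(RintegralD mA iYA icA).
apply: (nonpos_int_ae mA (integrableD_EFin mA iYA icA) _).2.
by apply: filterS Yc => w Yw _; rewrite subr_le0.
Qed.

Let integral_noise_le t A : <<s gen t>> A ->
  (\int[P]_(w in A) (alpha t ^+ 2 * vnorm (eps1 t w) ^+ 2)%:E
   <= (beta t * c_eps)%:E)%E.
Proof.
move=> FA; have mA := genF FA; have np := nonpos_int_noise FA.
have icA : P.-integrable A (EFin \o (fun=> beta t * c_eps)).
  exact: finite_measure_integrable_cst.
have -> : (\int[P]_(w in A) (alpha t ^+ 2 * vnorm (eps1 t w) ^+ 2)%:E =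
    \int[P]_(w in A) ((alpha t ^+ 2 * vnorm (eps1 t w) ^+ 2 - beta t * c_eps)%:E
      + (beta t * c_eps)%:E))%E.
  by apply: eq_integral => w _; rewrite -EFinD subrK.
rewrite (integralD mA np.1 icA) -[leRHS]add0e.
apply: leeD; first exact: nonpos_int_le0 np.
rewrite integral_cst// -[leRHS]mule1; apply: lee_wpmul2l.
  by rewrite lee_fin mulr_ge0 ?powR_ge0// ltW.
exact: probability_le1.
Qed.

(** The bound on [e n] over [A] makes the products integrable; each coordinate then integrates to
    exactly 0, since [e n] is known before time t. *)
Let nonpos_int_martingale n t A N : (n <= t)%N -> <<s gen n>> A ->
  (forall w, A w -> vnorm (e n w) <= N) ->
  nonpos_int P A (fun w => dot (e n w) (eps1 t w)).
Proof.
move=> nt FA eN; have mA := genF FA.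
apply: nonpos_int_sum => // i.
have [_ [iX [_ [_ X0]]]] := eps1_mds t i.
have eiN w : A w -> `|e n w i 0| <= N.
  by move=> Aw; apply: le_trans (ler_coord_vnorm _ _) (eN _ Aw).
split.
  apply: integrable_bounded_mul eiN => //; first exact: mgen (@gen_m n) (@ge n i).
  exact: integrableS iX.
have D0 B : <<s gen t>> B -> \int[P]_(w in B) eps1 t w i 0 = 0.
  by move=> FB; rewrite /Rintegral X0// integral0.
have gei : gmeasurable (gen t) (fun w => e n w i 0).
  by apply: gmeasurableS (@ge n i); exact: gen_le.
by rewrite (bounded_mul_integral0 (@gen_m t) iX D0 (genF_le nt FA) gei eiN).
Qed.

Let sqr_vnorm_le n (A : set T) N : (forall w, A w -> vnorm (e n w) <= N) ->
  forall w, A w -> `|vnorm (e n w) ^+ 2| <= N ^+ 2.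
Proof.
move=> eN w Aw; rewrite ger0_norm ?sqr_ge0// lerXn2r ?nnegrE ?vnorm_ge0 ?eN//.
exact: le_trans (vnorm_ge0 _) (eN _ Aw).
Qed.

(** The block sum is exchanged, entry by entry, for its conditional expectation [Y]: the difference
    integrates to 0 against the bounded past-measurable products x_i x_j, and the eigenvalue bound
    applies to [Y] pointwise. *)
Let nonpos_int_drift m A N : <<s gen (m * h)>> A ->
  (forall w, A w -> vnorm (e (m * h)%N w) <= N) ->
  nonpos_int P A (fun w => dot (e (m * h)%N w)
      ((\sum_(j < h) (Q (m * h + j)%N w + (Q (m * h + j)%N w)^T)) *m e (m * h)%N w)
    + lambda * vnorm (e (m * h)%N w) ^+ 2).
Proof.
move=> FA eN; have mA := genF FA.
have [Y [YE Yl]] := Q_stable m.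
pose S w := \sum_(m * h <= t < m.+1 * h) (Q t w + (Q t w)^T).
have SE w : S w = \sum_(j < h) (Q (m * h + j)%N w + (Q (m * h + j)%N w)^T).
  rewrite /S -{1}[(m * h)%N]add0n big_addn mulSnr addKn big_mkord.
  by apply: eq_bigr => j _; rewrite addnC.
pose x := e (m * h)%N.
have dotE w (B : 'M[R]_q) : dot (x w) (B *m x w) =
    \sum_i \sum_j (x w i 0 * x w j 0) * B i j.
  apply: eq_bigr => i _; rewrite mxE mulr_sumr; apply: eq_bigr => j _.
  by rewrite mulrCA mulrC.
rewrite (_ : (fun w => _) = fun w =>
  \sum_i \sum_j (x w i 0 * x w j 0) * (S w i j - Y w i j) +
  (\sum_i \sum_j (x w i 0 * x w j 0) * Y w i j + lambda * vnorm (x w) ^+ 2)); last first.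
  apply/funext => w; rewrite -SE dotE addrA; congr (_ + _).
  rewrite -big_split; apply: eq_bigr => i _; rewrite -big_split.
  by apply: eq_bigr => j _ /=; ring.
have gxx i j : gmeasurable (gen (m * h)) (fun w => x w i 0 * x w j 0).
  by apply: measurable_funM; exact: ge.
have mxx i j : measurable_fun A (fun w => x w i 0 * x w j 0).
  exact: mgen (@gen_m _) (gxx i j).
have xxN i j w : A w -> `|x w i 0 * x w j 0| <= N * N.
  move=> Aw; rewrite normrM; apply: ler_pM => //;
    exact: le_trans (ler_coord_vnorm _ _) (eN _ Aw).
apply: nonpos_intD => //.
  apply: nonpos_int_sum => // i; apply: nonpos_int_sum => // j.
  have [iX [_ [iY XY]]] := YE i j.
  have iXY : P.-integrable setT (EFin \o (fun w => S w i j - Y w i j)).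
    exact: (integrableB measurableT iX iY).
  split.
    by apply: integrable_bounded_mul (xxN i j) => //; exact: integrableS iXY.
  have D0 B : <<s gen (m * h)>> B -> \int[P]_(w in B) (S w i j - Y w i j) = 0.
    move=> FB; have mB := genF FB.
    have iXB : P.-integrable B (EFin \o (fun w => S w i j)) by exact: integrableS iX.
    have iYB : P.-integrable B (EFin \o (fun w => Y w i j)) by exact: integrableS iY.
    by rewrite (RintegralB mB iXB iYB) /Rintegral XY// subrr.
  by rewrite (bounded_mul_integral0 (@gen_m _) iXY D0 FA (gxx i j) (xxN i j)).
apply: nonpos_int_ae => //.
  apply: integrableD_EFin => //.
    apply: integrable_sum_EFin => // i; apply: integrable_sum_EFin => // j.
    apply: integrable_bounded_mul (xxN i j) => //.
    by have [_ [_ [iY _]]] := YE i j; exact: integrableS iY.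
  apply: integrableZl_EFin => //; apply: (@integrable_bounded _ _ _ _ _ _ (N ^+ 2)) => //.
    exact: mV.
  exact: sqr_vnorm_le.
apply: filterS Yl => w Yw _; rewrite -dotE.
by have := lambda_max_dot_le (x w) lambda_gt0 Yw; lra.
Qed.

Let A0_ge0 : 0 <= A0. Proof. exact: le_trans (ltW (alpha_gt0 0)) (alpha_le 0). Qed.
Let G2_ge0 : 0 <= G2. Proof. exact: le_trans (g2_ge0 0) (g2_le 0). Qed.

Let M := pi1 + G1.
Let M_ge k : pi1 + g1 k <= M. Proof. by rewrite lerD2l. Qed.

Let K1 := ((1 + A0 * M) ^+ h) ^+ 2.
Let C1 := 8 * K1 * h%:R * (1 + A0 * G2) + 1.
Let C2 := 2 + 4 * K1 * (M ^+ 2 * (h%:R * A0) ^+ 2 + 2 * h%:R * (1 + A0 * G2)).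
Let noise n w := \sum_(j < h) (alpha (n + j)%N ^+ 2 * vnorm (eps1 (n + j)%N w) ^+ 2
  + alpha (n + j)%N * g2 (n + j)%N).

Let K1_ge0 : 0 <= K1. Proof. exact: sqr_ge0. Qed.

Let AG_ge0 : 0 <= 1 + A0 * G2. Proof. by rewrite addr_ge0// mulr_ge0. Qed.

Let C1_ge0 : 0 <= C1.
Proof.
apply: addr_ge0 => //; apply: mulr_ge0 => //; apply: mulr_ge0 => //.
exact: mulr_ge0.
Qed.

Let C2_ge0 : 0 <= C2.
Proof.
have : 0 <= M ^+ 2 * (h%:R * A0) ^+ 2 by rewrite mulr_ge0 ?sqr_ge0.
have : 0 <= 2 * h%:R * (1 + A0 * G2) by rewrite !mulr_ge0.
move=> ? ?; apply: addr_ge0 => //; apply: mulr_ge0; last exact: addr_ge0.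
exact: mulr_ge0.
Qed.

Let e_shift n w k : e (n + k.+1)%N w = e (n + k)%N w
  + alpha (n + k)%N *: ((Q (n + k)%N w + Delta (n + k)%N w) *m e (n + k)%N w)
  + alpha (n + k)%N *: (eps1 (n + k)%N w + eps2 (n + k)%N w).
Proof. by rewrite addnS e_S. Qed.

Let path_growth n w k : tame w -> (k <= h)%N ->
  vnorm (e (n + k)%N w) ^+ 2 <= C2 * (vnorm (e n w) ^+ 2 + noise n w).
Proof.
move=> [QH DH eH] kh.
have := @perturbed_growth_le R q (fun k => e (n + k)%N w) (fun k => Q (n + k)%N w)
  (fun k => Delta (n + k)%N w) (fun k => eps1 (n + k)%N w) (fun k => eps2 (n + k)%N w)
  (fun k => alpha (n + k)%N) (fun k => g1 (n + k)%N) (fun k => g2 (n + k)%N)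
  A0 M G2 pi1 (e_shift n w) (fun k => ltW (alpha_gt0 _)) (fun k => alpha_le _)
  (fun k => QH _) (fun k => DH _) pi1_ge0 (fun k => g1_ge0 _) (fun k => M_ge _)
  (fun k => eH _) (fun k => g2_le _) h k kh.
by rewrite addn0.
Qed.

Let path_block n w : tame w ->
  vnorm (e (n + h)%N w) ^+ 2 <= vnorm (e n w) ^+ 2 * (1 +
      (2 * pi1 * (\sum_(j < h) `|alpha (n + j)%N - alpha n|)
       + 2 * (\sum_(j < h) alpha (n + j)%N * g1 (n + j)%N)
       + M ^+ 2 * (1 + 4 * K1) * (\sum_(j < h) alpha (n + j)%N) ^+ 2
       + \sum_(j < h) alpha (n + j)%N * g2 (n + j)%N))
    + alpha n * dot (e n w)
        ((\sum_(j < h) (Q (n + j)%N w + (Q (n + j)%N w)^T)) *m e n w)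
    + 2 * (\sum_(j < h) alpha (n + j)%N * dot (e n w) (eps1 (n + j)%N w))
    + C1 * noise n w.
Proof.
move=> [QH DH eH].
have := @perturbed_block_le R q (fun k => e (n + k)%N w) (fun k => Q (n + k)%N w)
  (fun k => Delta (n + k)%N w) (fun k => eps1 (n + k)%N w) (fun k => eps2 (n + k)%N w)
  (fun k => alpha (n + k)%N) (fun k => g1 (n + k)%N) (fun k => g2 (n + k)%N)
  A0 M G2 pi1 (e_shift n w) (fun k => ltW (alpha_gt0 _)) (fun k => alpha_le _)
  (fun k => QH _) (fun k => DH _) pi1_ge0 (fun k => g1_ge0 _) (fun k => M_ge _)
  (fun k => eH _) (fun k => g2_le _) h (alpha n).
by rewrite addn0.
Qed.

Let s m := \sum_(j < h) alpha (m * h + j)%N.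
(** Half of the drift lambda alpha(mh) absorbs the error terms; since s_m <= 2 h alpha(mh), the
    other half is at least kap s_m. *)
Let kap := lambda / (4 * h%:R).
Let bl m := \sum_(j < h) b (m * h + j)%N.

Let bl_ge0 m : 0 <= bl m. Proof. exact: sumr_ge0. Qed.
Let s_ge0 m : 0 <= s m. Proof. by apply: sumr_ge0 => j _; exact: ltW. Qed.
Let kap_gt0 : 0 < kap. Proof. by rewrite divr_gt0// mulr_gt0// ltr0n. Qed.

Let block_contraction : exists m0, forall m, (m0 <= m)%N ->
  kap * s m <= 1 /\
  forall A, <<s gen (m * h)>> A ->
    (\int[P]_(w in A) (vnorm (e (m.+1 * h)%N w) ^+ 2)%:E <=
     (1 - kap * s m)%:E * \int[P]_(w in A) (vnorm (e (m * h)%N w) ^+ 2)%:E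
       + (C1 * bl m)%:E)%E.
Proof.
have l2 : 0 < lambda / 2 by rewrite divr_gt0.
have [n0 _ small] := step_coefficients_small alpha_gt0 alpha_cvg0 pi1
  (M ^+ 2 * (1 + 4 * K1)) h_gt0 l2 alpha_inv g1_cvg0 g2_cvg0.
exists n0 => m m0m; set n := (m * h)%N.
have nn0 : (n0 <= n)%N by apply: leq_trans m0m _; exact: leq_pmulr.
have [rho_le [s_le la_le]] := small n nn0.
have ks : kap * s m <= lambda / 2 * alpha n.
  have -> : lambda / 2 * alpha n = kap * (2 * h%:R * alpha n).
    by rewrite /kap; field; rewrite pnatr_eq0 -lt0n.
  by rewrite ler_pM2l.
have ks1 : kap * s m <= 1 by exact: le_trans ks la_le.
split => //.
have trunc A N : <<s gen n>> A -> (forall w, A w -> vnorm (e n w) <= N) ->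
    (\int[P]_(w in A) (vnorm (e (m.+1 * h)%N w) ^+ 2)%:E <=
     (1 - kap * s m)%:E * \int[P]_(w in A) (vnorm (e n w) ^+ 2)%:E
       + (C1 * bl m)%:E)%E.
  move=> FA eN; have mA := genF FA.
  (* Gathers everything of nonpositive integral: the drift compensated by lambda V, the martingale
     term, and the squared noise minus its bound. *)
  pose np w := alpha n * (dot (e n w)
      ((\sum_(j < h) (Q (n + j)%N w + (Q (n + j)%N w)^T)) *m e n w)
      + lambda * vnorm (e n w) ^+ 2)
    + (2 * (\sum_(j < h) alpha (n + j)%N * dot (e n w) (eps1 (n + j)%N w))
    + C1 * (\sum_(j < h) (alpha (n + j)%N ^+ 2 * vnorm (eps1 (n + j)%N w) ^+ 2
         - beta (n + j)%N * c_eps))).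
  have npA : nonpos_int P A np.
    apply: nonpos_intD => //.
      by apply: nonpos_intZ => //; [exact: ltW|exact: nonpos_int_drift FA eN].
    apply: nonpos_intD => //.
      apply: nonpos_intZ => //; apply: nonpos_int_sum => // j.
      apply: nonpos_intZ => //; first exact: ltW.
      exact: nonpos_int_martingale (leq_addr _ _) FA eN.
    apply: nonpos_intZ => //; apply: nonpos_int_sum => // j.
    by apply: nonpos_int_noise; exact: genF_le (leq_addr _ _) FA.
  have iV : P.-integrable A (EFin \o (fun w => vnorm (e n w) ^+ 2)).
    apply: (@integrable_bounded _ _ _ _ _ _ (N ^+ 2)) => //.
    exact: sqr_vnorm_le.
  have iZV : P.-integrable A (EFin \o (fun w => (1 - kap * s m) * vnorm (e n w) ^+ 2)).
    exact: integrableZl_EFin.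
  have icA : P.-integrable A (EFin \o (fun=> C1 * bl m)).
    exact: finite_measure_integrable_cst.
  have ibase := integrableD_EFin mA iZV icA.
  have V_le : \forall w \ae P, A w -> vnorm (e (m.+1 * h)%N w) ^+ 2 <=
      ((1 - kap * s m) * vnorm (e n w) ^+ 2 + C1 * bl m) + np w.
    apply: filterS tame_ae => w /(path_block n) + _.
    rewrite mulSnr -/n => /le_trans; apply.
    have -> : noise n w = \sum_(j < h) (alpha (n + j)%N ^+ 2 * vnorm (eps1 (n + j)%N w) ^+ 2
        - beta (n + j)%N * c_eps) + bl m.
      rewrite -big_split; apply: eq_bigr => j _; rewrite /b -/n /=; ring.
    have V0 : 0 <= vnorm (e n w) ^+ 2 by exact: sqr_ge0.
    have := ler_wpM2l V0 rho_le; have := ler_wpM2l V0 ks; rewrite /np.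
    set V := vnorm (e n w) ^+ 2; set D := dot _ (_ *m _); set S1 := \sum_(j < h) _ * dot _ _.
    move: (\sum_(j < h) (_ - _)) (bl m) (kap * s m) (_ + _ + _ + _) => Z B ks' rho'.
    lra.
  apply: le_trans (ae_le_integral mA (@mV _ A) _ (integrableD_EFin mA ibase npA.1) V_le) _.
    by move=> w _; exact: sqr_ge0.
  rewrite (integralD mA ibase npA.1) -[leRHS]adde0; apply: leeD; last exact: nonpos_int_le0 npA.
  rewrite (integralD mA iZV icA) (integralZl mA iV); apply: leeD2l.
  rewrite integral_cst// -[leRHS]mule1; apply: lee_wpmul2l.
    by rewrite lee_fin mulr_ge0.
  exact: probability_le1.
move=> A FA; have mA := genF FA.
(* Past events exhausting [A] on which [e n] is bounded; monotone convergence removes the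
   truncation, with integrals allowed to be infinite. *)
pose AN k := A `&` [set w | vnorm (e n w) ^+ 2 < k%:R].
have FAN k : <<s gen n>> (AN k) by apply: gen_setI => //; exact: gmeasurable_lt (@gV n).
have ANU : \bigcup_k AN k = A.
  apply/seteqP; split => [w [k _ []]//|w Aw].
  by exists (Num.truncn (vnorm (e n w) ^+ 2)).+1 => //; split => //=; exact: truncnS_gt.
have cv : (\int[P]_(w in AN k) (vnorm (e (m.+1 * h)%N w) ^+ 2)%:E @[k --> \oo] -->
    \int[P]_(w in A) (vnorm (e (m.+1 * h)%N w) ^+ 2)%:E)%E.
  rewrite -[X in _ --> (integral _ X _)]ANU; apply: ge0_nondecreasing_set_cvg_integral.
  - apply/nondecreasing_seqP => k; apply/subsetPset => w [Aw /= wk]; split => //=.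
    by apply: lt_le_trans wk _; rewrite ler_nat.
  - by move=> k; exact: genF (FAN k).
  - by move=> k; apply/measurable_EFinP; exact: mV.
  - by move=> k w _; rewrite lee_fin sqr_ge0.
rewrite -(cvg_lim _ cv)//; apply: lime_le; first by apply/cvg_ex; eexists; exact: cv.
apply: nearW => k; apply: le_trans (trunc _ (1 + k%:R) (FAN k) _) _.
  (* From y <= y^2 + 1/4, a bound k on the squared norm gives 1 + k on the norm without a square
     root. *)
  move=> w [_ /= Vk]; have := sqr_ge0 (vnorm (e n w) - 2^-1); lra.
apply: leeD2r; apply: lee_wpmul2l; first by rewrite lee_fin subr_ge0.
apply: ge0_subset_integral => //.
- exact: genF (FAN k).
- by apply/measurable_EFinP; exact: mV.
- by move=> w _; rewrite lee_fin sqr_ge0.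
- exact: subIsetl.
Qed.

Let moment n := (\int[P]_w (vnorm (e n w) ^+ 2)%:E)%E.

Let moment_growth n k : (k <= h)%N ->
  (moment (n + k) <= C2%:E * (moment n + (\sum_(j < h) b (n + j)%N)%:E))%E.
Proof.
move=> kh.
have noise_term_ge0 j w : 0 <= alpha (n + j)%N ^+ 2 * vnorm (eps1 (n + j)%N w) ^+ 2
    + alpha (n + j)%N * g2 (n + j)%N.
  by rewrite addr_ge0// mulr_ge0 ?sqr_ge0// ltW.
have mterm j : measurable_fun setT (fun w =>
    alpha (n + j)%N ^+ 2 * vnorm (eps1 (n + j)%N w) ^+ 2 + alpha (n + j)%N * g2 (n + j)%N).
  by apply: measurable_funD; [exact: mN|exact: measurable_cst].
have mnoise : measurable_fun setT (noise n) by apply: measurable_sum => j; exact: mterm.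
have noise_ge0 w : 0 <= noise n w by apply: sumr_ge0 => j _; exact: noise_term_ge0.
apply: (@le_trans _ _ (\int[P]_w (C2%:E * ((vnorm (e n w) ^+ 2)%:E + (noise n w)%:E)))%E).
  apply: ae_ge0_le_integral => //.
  - by move=> w _; rewrite lee_fin sqr_ge0.
  - by apply/measurable_EFinP; exact: mV.
  - by move=> w _; rewrite lee_fin mulr_ge0// addr_ge0 ?sqr_ge0.
  - apply/measurable_EFinP; apply: measurable_funM; first exact: measurable_cst.
    by apply: measurable_funD => //; exact: mV.
  - by apply: filterS tame_ae => w /path_growth H _; rewrite lee_fin; exact: H.
rewrite ge0_integralZl_EFin//; last 2 first.
- by move=> w _; rewrite lee_fin addr_ge0 ?sqr_ge0.
- apply/measurable_EFinP; apply: measurable_funD => //; exact: mV.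
apply: lee_wpmul2l; first by rewrite lee_fin.
rewrite ge0_integralD//; last 4 first.
- by move=> w _; rewrite lee_fin sqr_ge0.
- by apply/measurable_EFinP; exact: mV.
- by move=> w _; rewrite lee_fin.
- exact/measurable_EFinP.
apply: leeD2l; rewrite /noise; under eq_integral do rewrite -sumEFin.
rewrite ge0_integral_sum//; last 2 first.
- by move=> j; apply/measurable_EFinP; exact: mterm.
- by move=> j w _; rewrite lee_fin.
rewrite -sumEFin; apply: lee_sum => j _; under eq_integral do rewrite EFinD.
rewrite ge0_integralD//; last 3 first.
- by move=> w _; rewrite lee_fin mulr_ge0 ?sqr_ge0.
- by apply/measurable_EFinP; exact: mN.
- by move=> w _; rewrite lee_fin mulr_ge0// ltW.
rewrite /b EFinD; apply: leeD; first by apply: integral_noise_le; exact: gen_setT.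
by rewrite integral_cst// [X in (_ * X)%E](probability_setT P) mule1.
Qed.

Let moment_ge0 n : (0 <= moment n)%E.
Proof. by apply: integral_ge0 => w _; rewrite lee_fin sqr_ge0. Qed.

(** The deterministic start has finite moment, and [moment_growth], an inequality between extended
    reals, propagates finiteness. *)
Let moment_fin m : moment (m * h) \is a fin_num.
Proof.
rewrite ge0_fin_numE//; elim: m => [|m IH].
  rewrite /moment mul0n; under eq_integral do rewrite e_0.
  by rewrite integral_cst// [X in (_ * X)%E](probability_setT P) mule1 ltry.
rewrite mulSnr; apply: le_lt_trans (moment_growth _ (leqnn h)) _.
by rewrite lte_mul_pinfty// ?lee_fin// lte_add_pinfty// ltry.
Qed.

Let v m := fine (moment (m * h)).
Let vE m : moment (m * h) = (v m)%:E. Proof. by rewrite fineK. Qed.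

Let b_cvg0 : b @ \oo --> 0.
Proof.
have d1 : 0 < 1 - 2 * delta by move: delta_lt; lra.
have H := powR_cvg0_base d1 (fun n => ltW (alpha_gt0 n)) alpha_cvg0.
rewrite (_ : b = fun t => alpha t * alpha t `^ (1 - 2 * delta) * c_eps + alpha t * g2 t); last first.
  by apply/funext => t; rewrite /b betaE.
have -> : (0 : R) = 0 * 0 * c_eps + 0 * 0 by ring.
apply: cvgD; last exact: cvgM.
by apply: cvgM; [exact: cvgM|exact: cvg_cst].
Qed.

Let cvg_block (u : nat -> R) (l : R) j :
  u @ \oo --> l -> (fun m => u (m * h + j)%N) @ \oo --> l.
Proof.
move=> ul; apply: (@cvg_comp _ _ _ (fun m => m * h + j)%N u _ \oo) => //.
move=> A [N _ HN]; exists N => // m Nm; apply: HN.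
by apply: leq_trans Nm (leq_trans (leq_pmulr _ h_gt0) (leq_addr _ _)).
Qed.

Let block_sum_cvg0 (u : nat -> R) : u @ \oo --> 0 ->
  (fun m => \sum_(j < h) u (m * h + j)%N) @ \oo --> 0.
Proof.
move=> u0.
have := @cvg_sum_ord R h (fun j m => u (m * h + j)%N) (fun=> 0) (fun j => cvg_block j u0).
by rewrite big1.
Qed.

Let v_cvg0 : v @ \oo --> 0.
Proof.
have [m0 Hm0] := block_contraction.
(* This is b / alpha, which tends to 0; bounding each step size by the block sum puts the defect in
   the form s_m r_m. *)
pose y t := alpha t `^ (1 - 2 * delta) * c_eps + g2 t.
have y0 t : 0 <= y t by rewrite addr_ge0// mulr_ge0 ?powR_ge0// ltW.
apply: (@contraction_cvg0 _ v s (fun m => C1 * \sum_(j < h) y (m * h + j)%N) kap m0) => //.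
- by move=> m; exact: fine_ge0.
- by move=> m /Hm0 [].
- move=> m /Hm0 [_ H].
  have FT : <<s gen (m * h)>> setT by exact: gen_setT.
  have := H _ FT; rewrite -/(moment _) -/(moment _) !vE.
  rewrite -EFinM -EFinD lee_fin => /le_trans; apply; rewrite lerD2l mulrCA.
  rewrite ler_wpM2l// mulr_sumr; apply: ler_sum => j _.
  have -> : b (m * h + j)%N = alpha (m * h + j)%N * y (m * h + j)%N.
    by rewrite /b betaE /y; ring.
  rewrite ler_wpM2r// /s (bigD1 j)//= lerDl sumr_ge0// => i _; exact: ltW.
- have d1 : 0 < 1 - 2 * delta by move: delta_lt; lra.
  have H := powR_cvg0_base d1 (fun n => ltW (alpha_gt0 n)) alpha_cvg0.
  have ycv : y @ \oo --> 0.
    have -> : (0 : R) = 0 * c_eps + 0 by ring.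
    by apply: cvgD => //; apply: cvgM => //; exact: cvg_cst.
  have : (fun m => C1 * \sum_(j < h) y (m * h + j)%N) @ \oo --> C1 * 0.
    by apply: cvgM; [exact: cvg_cst|exact: block_sum_cvg0].
  by rewrite mulr0.
- apply/cvgryPge => B; move/cvgryPge : alpha_sum => /(_ B) [N _ HN].
  exists N => // n /= Nn.
  have -> : \sum_(m < n) s m = \sum_(0 <= t < n * h) alpha t.
    rewrite big_mkord; exact: (sum_blocks alpha h 0 n).
  by apply: HN; apply: leq_trans Nn _; exact: leq_pmulr.
Qed.

Let step_noise_cvg0 : (fun t => alpha t * g2 t) @ \oo --> 0.
Proof. by rewrite -(mulr0 0); exact: cvgM. Qed.

Let cvg_by_blocks (u x : nat -> R) : (forall t, 0 <= u t) ->
  (forall m k, (k <= h)%N -> u (m * h + k)%N <= x m) -> x @ \oo --> 0 -> u @ \oo --> 0.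
Proof.
move=> u0 ux /cvgr0Pnorm_lt x0; apply/cvgr0Pnorm_lt => eps eps0.
have [N _ HN] := x0 _ eps0.
exists (N * h)%N => // t /= Nt; rewrite ger0_norm//.
have /HN /= : (N <= t %/ h)%N by rewrite leq_divRL.
apply: le_lt_trans; apply: le_trans (ler_norm _); rewrite {1}(divn_eq t h).
by apply: ux; rewrite ltnW// ltn_mod.
Qed.

Lemma second_moment_cvg0 :
  (fun t => ('E_P[(fun w => vnorm (e t w) ^+ 2)%R])%E) @ \oo --> 0%E.
Proof.
have mom t : ('E_P[(fun w => vnorm (e t w) ^+ 2)%R] = moment t)%E.
  by rewrite unlock.
have fin t : moment t \is a fin_num.
  rewrite ge0_fin_numE// (divn_eq t h).
  apply: le_lt_trans (moment_growth _ (ltnW _)) _; first by rewrite ltn_mod.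
  by rewrite vE lte_mul_pinfty// ?lee_fin// -EFinD ltry.
under eq_fun do rewrite mom.
apply: cvg_EFin; first by apply: nearW => t; exact: fin.
apply: (@cvg_by_blocks _ (fun m => C2 * (v m + bl m))).
- by move=> t; apply: fine_ge0; exact: moment_ge0.
- move=> m k kh; rewrite -lee_fin fineK//.
  by apply: le_trans (moment_growth _ kh) _; rewrite vE.
- have -> : (0 : R) = C2 * (0 + 0) by ring.
  apply: cvgM; first exact: cvg_cst.
  by apply: cvgD; [exact: v_cvg0|exact: block_sum_cvg0].
Qed.

(** * Almost sure convergence *)

Section almost_sure.
Hypothesis beta_sum : (\sum_(1 <= t <oo) ((alpha t `^ (2 * (1 - delta)))%:E) < +oo)%E.
Hypothesis g2_sum : (\sum_(1 <= t <oo) ((alpha t * g2 t)%:E) < +oo)%E.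

Let b_sum : (\sum_(1 <= t <oo) (b t)%:E < +oo)%E.
Proof.
under eq_eseriesr do rewrite EFinD.
rewrite nneseriesD; last 2 first.
- by move=> t _ _; rewrite lee_fin mulr_ge0 ?powR_ge0// ltW.
- by move=> t _ _; rewrite lee_fin mulr_ge0// ltW.
apply: lte_add_pinfty => //.
under eq_eseriesr do rewrite mulrC EFinM.
rewrite nneseriesZl; last by move=> t _; rewrite lee_fin powR_ge0.
by rewrite lte_mul_pinfty// lee_fin ltW.
Qed.

(** The contraction factor is weakened to 1; its effect survives through [v_cvg0], which supplies
    starting blocks of small mean. *)
Let V_ae_cvg0 : \forall w \ae P, (fun m => vnorm (e (m * h)%N w) ^+ 2) @ \oo --> 0.
Proof.
have [m0 Hm0] := block_contraction.
apply: (@almost_supermartingale_cvg0 _ _ _ P (fun m => gen (m * h))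
  (fun m w => vnorm (e (m * h)%N w) ^+ 2) (fun m => C1 * bl m) m0).
- by move=> n; exact: gen_m.
- by move=> n; apply: gen_le; rewrite mulSn leq_addl.
- by move=> n; exact: gV.
- by move=> n w; exact: sqr_ge0.
- move=> m A m0m FA; have [ks1 /(_ _ FA) /le_trans] := Hm0 m m0m; apply.
  apply: leeD2r; rewrite -[leRHS]mul1e; apply: lee_wpmul2r.
    by apply: integral_ge0 => w _; rewrite lee_fin sqr_ge0.
  by rewrite lee_fin gerBl mulr_ge0// ltW.
- move=> eta eta0; have eta2 : 0 < eta / 2 by rewrite divr_gt0.
  have eta3 : 0 < eta / (2 * (C1 + 1)) by rewrite divr_gt0// mulr_gt0// ltr_pwDr.
  have [N _ HN] := summable_tail_le b_ge0 b_sum eta3.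
  have [N' _ HN'] := cvgr_le _ v_cvg0 _ eta2.
  exists (maxn m0 (maxn N N')); first exact: leq_maxl.
  set n := maxn _ _ => k; rewrite -/(moment _) vE -EFinD lee_fin.
  have n1 : (N <= n)%N by rewrite /n !leq_max leqnn orbT.
  have n2 : (N' <= n)%N by rewrite /n !leq_max leqnn !orbT.
  have := HN' n n2 => /= vn.
  have := HN (n * h)%N (leq_trans n1 (leq_pmulr _ h_gt0)) (k * h)%N => /=.
  rewrite -sum_blocks -mulr_sumr => /(ler_wpM2l C1_ge0).
  have : C1 * (eta / (2 * (C1 + 1))) <= eta / 2.
    have D0 : 0 < C1 + 1 by rewrite ltr_pwDr.
    have -> : C1 * (eta / (2 * (C1 + 1))) = eta / 2 * (C1 / (C1 + 1)).
      by field; rewrite gt_eqF.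
    by rewrite ler_piMr ?(ltW eta2)// ler_pdivrMr// mul1r lerDl.
  rewrite /bl; lra.
Qed.

(* Over an F(t)-set the next noise term integrates to at most [b t.+1], so the
   noise is trivially an almost supermartingale with this defect. *)
Let noise_ae_cvg0 : \forall w \ae P,
  (fun t => alpha t ^+ 2 * vnorm (eps1 t w) ^+ 2) @ \oo --> 0.
Proof.
have noise0 t w : 0 <= alpha t ^+ 2 * vnorm (eps1 t w) ^+ 2.
  by rewrite mulr_ge0 ?sqr_ge0.
have beta_b t : beta t * c_eps <= b t by rewrite lerDl mulr_ge0// ltW.
apply: (@almost_supermartingale_cvg0 _ _ _ P (fun t => gen t.+1)
  (fun t w => alpha t ^+ 2 * vnorm (eps1 t w) ^+ 2) (fun t => b t.+1) 0).
- by move=> n; exact: gen_m.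
- by move=> n; exact: gen_le.
- by move=> n; exact: gN.
- exact: noise0.
- move=> t A _ FA; apply: le_trans (integral_noise_le FA) _.
  rewrite -[leLHS]add0e; apply: leeD; last by rewrite lee_fin.
  by apply: integral_ge0 => w _; rewrite lee_fin.
- move=> eta eta0; have [N _ HN] := summable_tail_le b_ge0 b_sum eta0.
  exists N => // k; have := HN N (leqnn N) k.+1.
  have FT : <<s gen N>> setT by exact: gen_setT.
  (* The mean at N costs [b N] and the defects are its successors, so together they form one tail of
     k + 1 terms. *)
  rewrite big_ord_recl/= addn0 -lee_fin; apply: le_trans; rewrite EFinD.
  apply: leeD; first by apply: le_trans (integral_noise_le FT) _; rewrite lee_fin.
  by rewrite lee_fin; apply: ler_sum => j _; rewrite addnS.
Qed.

Lemma ae_cvg0 : \forall w \ae P, (fun t => vnorm (e t w) ^+ 2) @ \oo --> 0.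
Proof.
near=> w; apply: (@cvg_by_blocks _ (fun m => C2 * (vnorm (e (m * h)%N w) ^+ 2 + noise (m * h) w))).
- by move=> t; exact: sqr_ge0.
- move=> m k kh; apply: path_growth => //; near: w; exact: tame_ae.
- have -> : (0 : R) = C2 * (0 + 0) by ring.
  apply: cvgM; first exact: cvg_cst.
  apply: cvgD; first by near: w; exact: V_ae_cvg0.
  apply: (@block_sum_cvg0 (fun t => alpha t ^+ 2 * vnorm (eps1 t w) ^+ 2 + alpha t * g2 t)).
  rewrite -(addr0 0); apply: cvgD => //.
  by near: w; exact: noise_ae_cvg0.
Unshelve. all: by end_near.
Qed.

(** An almost everywhere statement only places the exceptional set inside a null set; measurability
    is needed to give the convergence event probability 1. *)
Let measurable_cvg0 : measurable [set w | e ^~ w @ \oo --> (0 : 'cV[R]_q)].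
Proof.
rewrite (_ : [set w | _] = \bigcap_i \bigcup_N \bigcap_(n in [set n | (N <= n)%N])
    \bigcap_(k in [set: 'I_q]) [set w | `|e n w k 0| < i.+1%:R^-1]).
  apply: bigcapT_measurable => i; apply: bigcupT_measurable => N.
  apply: bigcap_measurable; first by exists N => /=.
  move=> n _; apply: fin_bigcap_measurable => // k _.
  apply: (@genF n); apply: gmeasurable_lt.
  exact: (measurableT_comp (@normr_measurable _ _) (@ge n k)).
apply/seteqP; split => w /=.
  move=> /cV_cvg0P H i _; have [N HN] := H i; exists N => // n Nn k _; exact: HN.
move=> H; apply/cV_cvg0P => i; have [N _ HN] := H i I; exists N => n Nn k.
exact: HN Nn _ I.
Qed.

Lemma almost_sure_cvg0 : P [set w | e ^~ w @ \oo --> (0 : 'cV[R]_q)] = 1%E.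
Proof.
set S := [set w | _].
suff S0 : P (~` S) = 0%E.
  by rewrite -[S]setCK (probability_setC P (measurableC measurable_cvg0)) S0 sube0.
apply/(measure_negligible (measurableC measurable_cvg0)).
apply: filterS ae_cvg0 => w V0 /=.
apply/cV_cvg0P => i.
have i0 : (0 : R) < i.+1%:R^-1 ^+ 2 by rewrite exprn_gt0// invr_gt0 ltr0n.
move/cvgr0Pnorm_lt : V0 => /(_ _ i0) [N _ HN]; exists N => n /HN /= Vn k.
apply: le_lt_trans (ler_coord_vnorm _ _) _.
rewrite -(@ltr_pXn2r _ 2) ?nnegrE ?vnorm_ge0 ?invr_ge0//.
exact: le_lt_trans (ler_norm _) Vn.
Qed.

End almost_sure.

End recursion.

Theorem theorem4 (R : realType) (d : measure_display) (T : measurableType d)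
  (P : probability T R) (q : nat)
  (alpha : nat -> R)
  (Q Delta : nat -> T -> 'M[R]_q) (eps1 eps2 : nat -> T -> 'cV[R]_q)
  (e0 : 'cV[R]_q) (e : nat -> T -> 'cV[R]_q)
  (h : nat) (lambda pi1 c_eps delta : R) (g1 g2 : nat -> R) :
  (* random quantities are random variables *)
  (forall t (i j : 'I_q), measurable_fun setT (fun w => Q t w i j)) ->
  (forall t (i j : 'I_q), measurable_fun setT (fun w => Delta t w i j)) ->
  (forall t (i : 'I_q), measurable_fun setT (fun w => eps1 t w i 0)) ->
  (forall t (i : 'I_q), measurable_fun setT (fun w => eps2 t w i 0)) ->
  (* the recursion with deterministic initial condition *)
  (forall w, e 0%N w = e0) ->
  (forall t w, e t.+1 w = e t w + alpha t *: ((Q t w + Delta t w) *m e t w)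
                          + alpha t *: (eps1 t w + eps2 t w)) ->
  (* Assumption 3 (i) *)
  (forall t, 0 < alpha t) ->
  alpha @ \oo --> 0 ->
  (fun n => \sum_(0 <= t < n) alpha t) @ \oo --> +oo ->
  (exists alpha0 : R, 0 <= alpha0 /\
     (fun t => (alpha t.+1)^-1 - (alpha t)^-1) @ \oo --> alpha0) ->
  (* Assumption 3 (ii.a) *)
  (\forall w \ae P, forall t, opnorm (Q t w) <= pi1) ->
  (0 < h)%N -> 0 < lambda ->
  (forall m : nat, exists Y : T -> 'M[R]_q,
     (forall i j : 'I_q,
        is_cond_exp P (Fpast Q Delta eps1 (m * h))
          (fun w => (\sum_(m * h <= t < m.+1 * h) (Q t w + (Q t w)^T)) i j)
          (fun w => Y w i j)) /\
     (\forall w \ae P, lambda_max (Y w) <= - lambda)) ->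
  (* Assumption 3 (ii.b) *)
  (\forall w \ae P, forall t, opnorm (Delta t w) <= g1 t) ->
  g1 @ \oo --> 0 -> (exists M : R, forall t, g1 t <= M) ->
  (* Assumption 3 (iii.a) *)
  mds P (Fpast Q Delta eps1) eps1 ->
  0 < c_eps -> 0 <= delta < 1 / 2 ->
  (forall t, exists Y : T -> R,
     is_cond_exp P (Fpast Q Delta eps1 t)
       (fun w => vnorm ((alpha t `^ delta) *: eps1 t w) ^+ 2) Y /\
     (\forall w \ae P, Y w <= c_eps)) ->
  (* Assumption 3 (iii.b) *)
  (forall t (i : 'I_q),
     G_measurable (Fpast Q Delta eps1 t.+1) (fun w => eps2 t w i 0)) ->
  (\forall w \ae P, forall t, vnorm (eps2 t w) <= g2 t) ->
  g2 @ \oo --> 0 -> (exists M : R, forall t, g2 t <= M) ->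
  (* conclusions *)
  ((fun t => ('E_P[(fun w => vnorm (e t w) ^+ 2)%R])%E) @ \oo --> 0%E) /\
  ((\sum_(1 <= t <oo) ((alpha t `^ (2 * (1 - delta)))%:E) < +oo)%E ->
   (\sum_(1 <= t <oo) ((alpha t * g2 t)%:E) < +oo)%E ->
   forall (u : nat -> T -> 'M[R]_q) (w : nat -> T -> 'cV[R]_q),
     (forall t (i j : 'I_q), measurable_fun setT (fun x => u t x i j)) ->
     (forall t (i : 'I_q), measurable_fun setT (fun x => w t x i 0)) ->
     (forall t x, eps1 t x = u t x *m w t x) ->
     indep_sigma P (<<s gen_sets w >>)
                   (<<s gen_sets Q `|` gen_sets Delta `|` gen_sets u >>) ->
     mds P (Fpast Q Delta eps1) w ->
     P [set x | e ^~ x @ \oo --> (0 : 'cV[R]_q)] = 1%E).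
Proof.
move=> mQ mDelta meps1 _ e_0 e_S alpha_gt0 alpha_cvg0 alpha_sum [alpha0 [_ alpha_inv]].
move=> Q_le h_gt0 lambda_gt0 Q_stable Delta_le g1_cvg0 [G1 g1_le] eps1_mds c_eps_gt0.
move=> /andP[_ delta_lt] eps1_var meps2 eps2_le g2_cvg0 [G2 g2_le].
have [A0 alpha_le] : exists A0, forall t, alpha t <= A0.
  have /cvg_seq_bounded [M [_ HM]] : cvgn alpha by apply/cvg_ex; exists 0.
  exists (M + 1) => t; apply: le_trans (ler_norm _) _.
  by apply: HM => //; rewrite ltrDl.
split.
  exact: (@second_moment_cvg0 R d T P q alpha Q Delta eps1 eps2 e0 e h lambda
    pi1 c_eps delta g1 g2 alpha0 A0 G1 G2).
move=> beta_sum g2_sum _ _ _ _ _ _ _.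
exact: (@almost_sure_cvg0 R d T P q alpha Q Delta eps1 eps2 e0 e h lambda
  pi1 c_eps delta g1 g2 alpha0 A0 G1 G2).
Qed.
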